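(* Let $S^n=\{x\in\mathbb{R}^{n+1}:\|x\|=1\}$ be the sphere of dimension $n\le 3$. Then every Darboux bijection $f:S^n\to S^n$ is a homeomorphism.
   Context: Maps are not assumed continuous. A map $f:X\to Y$ between topological spaces is Darboux if for every connected subspace $C\subset X$ the image $f(C)$ is connected. A Darboux bijection is a bijective Darboux map. *)

(* Defs.v *)
From HB Require Import structures.
From mathcomp Require Import all_boot all_order all_algebra.
From mathcomp Require Import all_classical all_reals all_analysis.
Import Order.TTheory GRing.Theory Num.Theory.
Import numFieldNormedType.Exports.

Set Implicit Arguments.
Unset Strict Implicit.
Unset Printing Implicit Defensive.

Local Open Scope classical_set_scope.
Local Open Scope ring_scope.

(* The library norm on 'rV[R]_m is the sup norm, so the Euclidean one is
   defined here; both induce the (product) topology of 'rV[R]_m. *)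
Definition euclidean_norm (R : realType) (m : nat) (x : 'rV[R]_m) : R :=
  Num.sqrt (\sum_(i < m) x 0 i ^+ 2).

(* As a type, [sphere R n] is [set_type (sphere R n)], which the library
   equips with the subspace topology (initial topology of the inclusion). *)
Definition sphere (R : realType) (n : nat) : set 'rV[R]_n.+1 :=
  [set x | euclidean_norm x = 1].
Arguments sphere R n : clear implicits.

Definition Darboux (X Y : topologicalType) (f : X -> Y) : Prop :=
  forall C : set X, connected C -> connected (f @` C).

Definition homeomorphism (X Y : topologicalType) (f : X -> Y) : Prop :=
  continuous f /\
  exists g : Y -> X, [/\ cancel f g, cancel g f & continuous g].

(* Main.v *)
Require Import Defs.
From HB Require Import structures.
From mathcomp Require Import all_boot all_order all_algebra.
From mathcomp Require Import all_classical all_reals all_analysis.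
From mathcomp Require Import ring lra.
Import Order.TTheory GRing.Theory Num.Theory.
Import numFieldNormedType.Exports.

Set Implicit Arguments.
Unset Strict Implicit.
Unset Printing Implicit Defensive.

Local Open Scope classical_set_scope.
Local Open Scope ring_scope.

(** The coordinates of a map into the sphere have connected images of connected sets,
    and the sphere is locally connected; hence it is enough to show that the preimage
    of every level [y 0 i = c] is closed ([closed_fibers_continuous]). Continuity of the
    inverse then comes from compactness. When [n <= 1] a level has at most two points,
    so only the dimensions two and three need an argument.

    A level [S] is a round sphere of dimension [n - 1]. If it cuts the sphere properly,
    the preimage of its complement has a disconnected image, hence is disconnected, and
    so the preimage of [S] contains a closed set [F] that already separates the sphere.
    It remains to prove that [f @` F = S], for then the preimage of [S] is [F].

    A closed set that separates the sphere carries a nontrivial Cech class of degree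
    [n - 1]. So it is enough to show, by induction on [j], that a compact set that
    carries a nontrivial class of degree [j], and that an injective Darboux map sends
    into a round sphere of dimension [j], is sent onto it ([filling_step]). Suppose
    that the point [z] of the round sphere is missed, and take a minimal carrier [K] of
    the class ([minimal_compact]). Cut the round sphere by a hyperplane through [z] that
    separates two points of the image of [K]. The preimage of the hyperplane separates
    [K] into two smaller closed sets ([disconnected_closed_cover]), on which the class
    vanishes, so by Mayer-Vietoris it comes from a nontrivial class of degree [j - 1] on
    their intersection. That intersection is sent into a round sphere of dimension
    [j - 1] containing [z], hence onto it by induction, and [z] is not missed.

    Only the degrees up to two occur, and the classes are represented by concrete
    objects. A class of degree one is a nowhere vanishing complex function, which is
    trivial when it has a continuous angle ([has_angle]). The class of degree two is
    that of the Hopf line bundle, which is trivial over the sets to which the Hopf map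
    can be lifted ([has_lift]); two lifts differ by a function to the circle, and this is
    the Mayer-Vietoris step ([has_lift_glue]).

    That separating sets carry nontrivial classes is proved in the stereographic chart,
    where they enclose the origin, by a gluing argument: if the class were trivial on
    [F], the function [x / |x|], respectively the Hopf bundle, could be replaced inside
    the enclosed region so as to be defined on a whole ball, where everything is
    trivialized by transport along the rays ([has_angle_ball], [projector_section]).
    But near the boundary of the ball it is not trivial, ultimately because the polar
    angle is not a continuous function ([no_angle_around_origin]). *)

(** * Separation and minimal carriers *)

(** Metric spaces are hereditarily normal: balls of half the distance to the other
    set are disjoint. *)
Lemma separated_open (R : realType) (X : pseudoMetricType R) (A B : set X) :
  separated A B ->
  exists U V, [/\ open U, open V, A `<=` U, B `<=` V & U `&` V = set0].
Proof.
have ball_of (P Q : set X) x : P x -> P `&` closure Q = set0 ->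
    exists e : R, 0 < e /\ forall y, Q y -> ~ ball x e y.
  move=> Px PQ0; have : ~ closure Q x by move=> cQx; rewrite -[False]/(set0 x) -PQ0.
  rewrite -[~ closure Q x]/((~` closure Q) x) -interiorC => /nbhs_ballP[e/= e0 xe].
  by exists e; split => // y Qy /xe; apply.
move=> [cAB0 AcB0].
have rA x : exists e : R, 0 < e /\ (A x -> forall y, B y -> ~ ball x e y).
  have [Ax|nAx] := pselect (A x); last by exists 1.
  by have [e [e0 ye]] := ball_of _ _ _ Ax AcB0; exists e.
have rB x : exists e : R, 0 < e /\ (B x -> forall y, A y -> ~ ball x e y).
  have [Bx|nBx] := pselect (B x); last by exists 1.
  have BcA0 : B `&` closure A = set0 by rewrite setIC.
  by have [e [e0 ye]] := ball_of _ _ _ Bx BcA0; exists e.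
have [eA eAP] := choice rA; have [eB eBP] := choice rB.
exists (\bigcup_(a in A) (ball a (eA a / 2))°), (\bigcup_(b in B) (ball b (eB b / 2))°).
split.
- by apply: bigcup_open => a _; exact: open_interior.
- by apply: bigcup_open => b _; exact: open_interior.
- move=> a Aa; exists a => //; apply: nbhsx_ballx.
  by have [? _] := eAP a; rewrite divr_gt0.
- move=> b Bb; exists b => //; apply: nbhsx_ballx.
  by have [? _] := eBP b; rewrite divr_gt0.
- rewrite -subset0 => x [[a Aa /interior_subset xa] [b Bb /interior_subset xb]].
  have [a0 /(_ Aa b Bb) nab] := eAP a; have [b0 /(_ Bb a Aa) nba] := eBP b.
  have ab := ball_triangle xa (ball_sym xb).
  have [le|/ltW le] := leP (eA a) (eB b).
    by apply: nba; apply/ball_sym; apply: le_ball ab; lra.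
  by apply: nab; apply: le_ball ab; lra.
Qed.

(** How a Darboux map is exploited: the image of [K] minus a fibre set [C] is seen to
    be disconnected, hence so is that set; as nothing is known about [C], the
    conclusion is phrased with closed sets overlapping inside [C]. *)
Lemma disconnected_closed_cover (R : realType) (X : pseudoMetricType R)
    (K C : set X) : closed K -> ~ connected (K `\` C) ->
  exists A B, [/\ closed A, closed B, A `|` B = K, A `&` B `<=` C
    & (exists2 x, K x & ~ A x) /\ (exists2 x, K x & ~ B x)].
Proof.
move=> cK /connectedPn[E [E0 EU Es]].
have [U [V [oU oV EUs EVs UV0]]] := separated_open Es.
have sE b : E b `<=` K.
  by move=> x Ebx; have [] : (K `\` C) x by rewrite EU; case: b Ebx; [right|left].
have UVn x : U x -> V x -> False by move=> Ux Vx; rewrite -[False]/(set0 x) -UV0.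
exists (K `\` V), (K `\` U); split.
- by rewrite setDE; apply: closedI => //; exact: open_closedC.
- by rewrite setDE; apply: closedI => //; exact: open_closedC.
- apply/seteqP; split => [x [[]|[]]//|x Kx].
  by have [Vx|nVx] := pselect (V x); [right; split => // Ux; exact: UVn Ux Vx|left].
- move=> x [[Kx nVx] [_ nUx]]; apply: contrapT => nCx.
  by have : (K `\` C) x by []; rewrite EU => -[/EUs|/EVs].
- split.
    by have [x Ex] := E0 true; exists x; [exact: sE Ex|move=> [_]; apply; exact: EVs].
  by have [x Ex] := E0 false; exists x; [exact: sE Ex|move=> [_]; apply; exact: EUs].
Qed.

(** A property of compact subsets of [F] that propagates from a compact set to the
    compact sets near it; by compactness this is continuity along decreasing
    intersections, as for vanishing of a Cech cohomology class. *)
Definition open_on_compacts (X : topologicalType) (F : set X) (T : set (set X)) :=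
  forall K, compact K -> K `<=` F -> T K -> exists U, [/\ open U, K `<=` U &
    forall L, compact L -> L `<=` F -> L `<=` U -> T L].

(** A Cech class that is nonzero on [K] has a minimal carrier [K0]: it vanishes on
    every smaller closed set. *)
Lemma minimal_compact (X : topologicalType) (T : set (set X)) (K : set X) :
  hausdorff_space X -> open_on_compacts K T -> compact K -> ~ T K ->
  exists K0, [/\ K0 `<=` K, compact K0, ~ T K0 &
    forall A, closed A -> A `<=` K0 -> (exists2 x, K0 x & ~ A x) -> T A].
Proof.
move=> hX oT cK nTK.
have clK : closed K by exact: compact_closed.
have KD B : open B -> compact (K `\` B).
  move=> oB; apply: (subclosed_compact _ cK); last by move=> x [].
  by rewrite setDE; apply: closedI => //; exact: open_closedC.
(* Zorn_bigcup maximizes unions, so the open complement of the carrier is grown *)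
pose P := [set B : set X | open B /\ ~ T (K `\` B)].
have [F FP totF|D [[oD nTD] Dmax]] := @Zorn_bigcup X P.
  have oF : open (\bigcup_(B in F) B) by apply: bigcup_open => B /FP[].
  split => // TF.
  have [U [oU KU TU]] := oT _ (KD _ oF) (@subDsetl _ _ _) TF.
  have [[B0 FB0]|F0] := pselect (exists B, F B); last first.
    apply: nTK; suff <- : K `\` \bigcup_(B in F) B = K by [].
    by apply/seteqP; split => [x []//|x Kx]; split => // -[B FB]; case: F0; exists B.
  have [[B FB sBU]|nB] := pselect (exists2 B, F B & K `\` B `<=` U).
    by have [oB] := FP _ FB; apply; apply: TU => //; exact: KD.
  (* otherwise the sets K \ U \ B, for B in the chain, accumulate at a point *)
  pose G := filter_from F (fun B => (K `\` U) `\` B).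
  have FG : ProperFilter G.
    apply: filter_from_proper.
      apply: filter_from_filter; first by exists B0.
      move=> B C FB FC; have [BC|CB] := totF _ _ FB FC.
        by exists C => // x [[Kx Ux] Cx]; split; split => //; move=> /BC.
      by exists B => // x [[Kx Ux] Bx]; split; split => //; move=> /CB.
    move=> B FB; apply: contrapT => /set0P/negP; rewrite negbK => /eqP E0.
    apply: nB; exists B => // x [Kx nBx]; apply: contrapT => nUx.
    by rewrite -[False]/(set0 x) -E0.
  have [|x [Kx Gx]] := cK G FG.
    by exists B0 => // x [[]].
  have clx B : F B -> ((K `\` U) `\` B) x.
    move=> FB; have cl : closed ((K `\` U) `\` B).
      rewrite !setDE; apply: closedI; last by apply: open_closedC; have [] := FP _ FB.
      by apply: closedI => //; exact: open_closedC.
    rewrite ((closure_id _).1 cl) => V nV; apply: Gx nV.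
    by exists B.
  have [[_ nUx] _] := clx _ FB0.
  by apply: nUx; apply: KU; split => // -[B /clx[_]].
exists (K `\` D); split => //; [exact: KD|].
move=> A cA AKD [x [Kx nDx] nAx]; apply: contrapT => nTA.
have AE : A = K `\` ~` A.
  rewrite setDE setCK; apply/seteqP; split => [y Ay|y []//].
  by split => //; have [] := AKD _ Ay.
apply: (Dmax (~` A)).
  rewrite properEneq; split.
    by apply/eqP => DA; apply: nDx; rewrite DA.
  by move=> y Dy Ay; have [] := AKD _ Ay.
by split; [exact: closed_openC|rewrite -AE].
Qed.

Lemma continuous_extension (R : realType) (X : pseudoMetricType R)
    (K : set X) (f : X -> R) : closed K -> compact K -> {within K, continuous f} ->
  exists2 g : X -> R, continuous g & forall x, K x -> f x = g x.
Proof.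
move=> clK cK cf.
have [M [Mr Mf]] := compact_bounded (continuous_compact cf cK).
have fM x : K x -> `|f x| <= `|M| + 1.
  move=> Kx; apply: Mf; last by exists x.
  by rewrite (le_lt_trans (ler_norm M))// ltrDl.
have M0 : 0 < `|M| + 1 by rewrite ltr_wpDl.
have [g [fg cg _]] := @continuous_bounded_extension X R (@pseudometric_normal R X)
  K clK f _ M0 cf fM.
by exists g => // x Kx; apply: fg; rewrite inE.
Qed.

Lemma glue_extension (R : realType) (X : pseudoMetricType R)
    (A B : set X) (f g : X -> R) : closed A -> closed B -> compact (A `|` B) ->
    {within A, continuous f} -> {within B, continuous g} ->
    (forall x, A x -> B x -> f x = g x) ->
  exists2 h : X -> R, continuous h &
    (forall x, A x -> h x = f x) /\ (forall x, B x -> h x = g x).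
Proof.
move=> cA cB cAB cf cg fg.
pose k x := if pselect (A x) then f x else g x.
have kA x : A x -> k x = f x by rewrite /k; case: pselect.
have kB x : B x -> k x = g x.
  by rewrite /k; case: pselect => // Ax Bx; exact: fg.
have ck : {within A `|` B, continuous k}.
  apply: withinU_continuous => //.
    by apply: (subspace_eq_continuous _ cf) => x; rewrite inE => /kA.
  by apply: (subspace_eq_continuous _ cg) => x; rewrite inE => /kB.
have [h ch kh] := continuous_extension (closedU cA cB) cAB ck.
exists h => //; split => x Hx; rewrite -kh; [exact: kA|by left|exact: kB|by right].
Qed.

(** * Continuity of real expressions, and continuous angles *)

Section real_continuity.
Context {R : realType} {T : topologicalType}.
Implicit Types f g : T -> R.

Lemma cont_cst (c : R) : continuous (fun _ : T => c).
Proof. by move=> x; exact: cvg_cst. Qed.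

Lemma cont_add f g : continuous f -> continuous g -> continuous (fun x => f x + g x).
Proof. by move=> cf cg x; apply: (@cvgD _ R^o); [exact: cf|exact: cg]. Qed.

Lemma cont_opp f : continuous f -> continuous (fun x => - f x).
Proof. by move=> cf x; apply: (@cvgN _ R^o); exact: cf. Qed.

Lemma cont_mul f g : continuous f -> continuous g -> continuous (fun x => f x * g x).
Proof. by move=> cf cg x; apply: cvgM; [exact: cf|exact: cg]. Qed.

Lemma cont_exp f n : continuous f -> continuous (fun x => f x ^+ n).
Proof.
move=> cf; elim: n => [|n IH].
  by rewrite (_ : (fun _ => _) = fun=> 1); [exact: cont_cst|apply/funext => x; rewrite expr0].
rewrite (_ : (fun _ => _) = fun x => f x * f x ^+ n); first exact: cont_mul.
by apply/funext => x; rewrite exprS.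
Qed.

Lemma cont_inv f : (forall x, f x != 0) -> continuous f -> continuous (fun x => (f x)^-1).
Proof. by move=> f0 cf x; apply: cvgV; [exact: f0|exact: cf]. Qed.

Lemma cont_compR f (h : R -> R) : continuous h -> continuous f ->
  continuous (fun x => h (f x)).
Proof. by move=> ch cf x; apply: continuous_comp; [exact: cf|exact: ch]. Qed.

Lemma cont_comp {S : topologicalType} (g : S -> R) (h : T -> S) : continuous g ->
  continuous h -> continuous (fun x => g (h x)).
Proof. by move=> cg ch x; apply: continuous_comp; [exact: ch|exact: cg]. Qed.

Lemma cont_sum (I : Type) (r : seq I) (F : I -> T -> R) :
  (forall i, continuous (F i)) -> continuous (fun x => \sum_(i <- r) F i x).
Proof.
move=> cF; elim: r => [|i r IH].
  rewrite (_ : (fun _ => _) = fun=> 0); first exact: cont_cst.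
  by apply/funext => x; rewrite big_nil.
rewrite (_ : (fun _ => _) = fun x => F i x + \sum_(j <- r) F j x); first exact: cont_add.
by apply/funext => x; rewrite big_cons.
Qed.

Lemma cont_max f g : continuous f -> continuous g -> continuous (fun x => Num.max (f x) (g x)).
Proof.
move=> cf cg; rewrite (_ : (fun _ => _) =
  fun x => (f x + g x + `|f x - g x|) * 2^-1).
  apply: cont_mul; last exact: cont_cst.
  apply: cont_add; first exact: cont_add.
  apply: (@cont_compR _ (fun x : R => `|x|)); first exact: (@norm_continuous R R^o).
  by apply: cont_add => //; exact: cont_opp.
apply/funext => x; case: (leP (f x) (g x)) => fg.
  by rewrite ler0_norm ?subr_le0//; lra.
by rewrite ger0_norm ?subr_ge0 ?ltW//; lra.
Qed.

Lemma cont_sqrt f : continuous f -> continuous (fun x => Num.sqrt (f x)).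
Proof. by apply: cont_compR; exact: sqrt_continuous. Qed.
Lemma cont_sin f : continuous f -> continuous (fun x => sin (f x)).
Proof. by apply: cont_compR; exact: continuous_sin. Qed.
Lemma cont_cos f : continuous f -> continuous (fun x => cos (f x)).
Proof. by apply: cont_compR; exact: continuous_cos. Qed.
Lemma cont_atan f : continuous f -> continuous (fun x => atan (f x)).
Proof. by apply: cont_compR; exact: continuous_atan. Qed.

Lemma open_gt0 f : continuous f -> open [set x | 0 < f x].
Proof.
by move=> cf; apply: (@open_comp _ _ f [set y | 0 < y]) => [x _|]; [exact: cf|exact: open_gt].
Qed.
Lemma open_neq0 f : continuous f -> open [set x | f x != 0].
Proof.
by move=> cf; apply: (@open_comp _ _ f [set y | y != 0]) => [x _|]; [exact: cf|exact: open_neq].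
Qed.
Lemma closed_eq0 f : continuous f -> closed [set x | f x = 0].
Proof.
by move=> cf; apply: (@preimage_closed _ _ f [set y | y = 0]) => [x _|];
  [exact: cf|exact: closed_eq].
Qed.
End real_continuity.

Ltac cont := try assumption; try lazymatch goal with
  |- forall x, continuous_at x ?f =>
    lazymatch f with
    | (fun y => @?a y + @?b y) => apply: (cont_add (f := a) (g := b)); cont
    | (fun y => @?a y * @?b y) => apply: (cont_mul (f := a) (g := b)); cont
    | (fun y => - @?a y) => apply: (cont_opp (f := a)); cont
    | (fun y => (@?a y) ^+ ?n) => apply: (cont_exp (f := a)); cont
    | (fun y => sin (@?a y)) => apply: (cont_sin (f := a)); cont
    | (fun y => cos (@?a y)) => apply: (cont_cos (f := a)); cont
    | (fun y => atan (@?a y)) => apply: (cont_atan (f := a)); cont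
    | (fun y => Num.sqrt (@?a y)) => apply: (cont_sqrt (f := a)); cont
    | (fun _ => ?c) => apply: cont_cst
    end end.

Lemma cont_inv_within (R : realType) (T : topologicalType) (K : set T) (f : T -> R) :
  (forall x, K x -> f x != 0) -> {within K, continuous f} ->
  {within K, continuous (fun x => (f x)^-1)}.
Proof.
move=> f0 cf; apply/(subspace_continuousP _) => x Kx; apply: cvgV; first exact: f0.
by move/subspace_continuousP: cf; exact.
Qed.

Section angles.
Context {R : realType}.
Implicit Types a b c d r s t : R.

(** [t] is an argument of the nonzero complex number [a + i b]. *)
Definition angle_of a b t := exists2 r, 0 < r & a = r * cos t /\ b = r * sin t.

Lemma angle_mul a b c d s t : angle_of a b s -> angle_of c d t ->
  angle_of (a * c - b * d) (a * d + b * c) (s + t).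
Proof.
move=> [r r0 [-> ->]] [q q0 [-> ->]]; exists (r * q); first exact: mulr_gt0.
by rewrite cosD sinD; split; ring.
Qed.

Lemma angle_conj a b t : angle_of a b t -> angle_of a (- b) (- t).
Proof. by move=> [r r0 [-> ->]]; exists r => //; rewrite cosN sinN mulrN. Qed.

Lemma angle_scale r a b t : 0 < r -> angle_of a b t -> angle_of (r * a) (r * b) t.
Proof.
move=> r0 [q q0 [-> ->]]; exists (r * q); first exact: mulr_gt0.
by rewrite !mulrA.
Qed.

Lemma angle_atan a b : 0 < a -> angle_of a b (atan (b / a)).
Proof.
move=> a0; have c0 : 0 < cos (atan (b / a)).
  by rewrite cos_atan invr_gt0 sqrtr_gt0 ltr_wpDr ?sqr_ge0.
exists (a / cos (atan (b / a))); first exact: divr_gt0.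
split; first by rewrite divfK// gt_eqF.
rewrite -mulrA [_^-1 * _]mulrC -/(tan _) atanK; field.
by rewrite gt_eqF.
Qed.

Lemma angle_diff a b s t : angle_of a b s -> angle_of a b t ->
  cos (s - t) = 1 /\ sin (s - t) = 0.
Proof.
move=> [r r0 [-> ->]] [q q0 [ec es]].
have rq : r = q.
  apply/eqP; rewrite -(@eqrXn2 _ 2) ?ltW//; apply/eqP.
  have := cos2Dsin2 s; have := cos2Dsin2 t => ht hs.
  transitivity ((r * cos s) ^+ 2 + (r * sin s) ^+ 2).
    by rewrite !exprMn -mulrDr hs mulr1.
  by rewrite ec es !exprMn -mulrDr ht mulr1.
move: ec es; rewrite rq => /(mulfI (lt0r_neq0 q0)) ec /(mulfI (lt0r_neq0 q0)) es.
rewrite cosB sinB ec es -!expr2 cos2Dsin2; split => //; ring.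
Qed.

Lemma angle_turn a b t c : cos c = 1 -> sin c = 0 -> angle_of a b t ->
  angle_of a b (t + c).
Proof.
move=> c1 s0 [r r0 [-> ->]]; exists r => //.
by rewrite cosD sinD c1 s0 !mulr0 !mulr1 subr0 addr0.
Qed.

End angles.

(** [u + i v] has a continuous logarithm on [K], up to its modulus: the map to the
    circle that it defines is trivial in the first Cech cohomology of [K].
    Demanding an angle defined on the whole space loses no generality for compact
    [K], by Tietze's theorem, and spares all continuity relative to [K]. *)
Definition has_angle (R : realType) (T : topologicalType) (u v : T -> R) (K : set T) :=
  exists2 t : T -> R, continuous t & forall x, K x -> angle_of (u x) (v x) (t x).

(** Where [u + i v] stays in the half plane centred on the direction of the old
    angle, the new angle is corrected by an arctangent. *)
Lemma has_angle_open (R : realType) (X : pseudoMetricType R) (F : set X) (u v : X -> R) :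
  hausdorff_space X -> continuous u -> continuous v ->
  open_on_compacts F (has_angle u v).
Proof.
move=> hX cu cv K cK _ [t ct Kt].
pose c x := u x * cos (t x) + v x * sin (t x).
pose d x := v x * cos (t x) - u x * sin (t x).
have cc : continuous c by rewrite /c; cont.
have cd : continuous d by rewrite /d; cont.
exists [set x | 0 < c x]; split; first exact: open_gt0.
  move=> x /Kt[r r0 [ux vx]]; rewrite /= /c ux vx -!mulrA -mulrDr -!expr2.
  by rewrite cos2Dsin2 mulr1.
move=> L cL _ Lc.
have cw : {within L, continuous (fun x => t x + atan (d x / c x))}.
  apply: cont_add; first exact: continuous_subspaceT.
  apply: cont_atan; apply: cont_mul; first exact: continuous_subspaceT.
  apply: cont_inv_within; last exact: continuous_subspaceT.
  by move=> x /Lc; exact: lt0r_neq0.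
have [s cs sE] := continuous_extension (compact_closed hX cL) cL cw.
exists s => // x Lx; rewrite -sE//.
have ct1 : angle_of (cos (t x)) (sin (t x)) (t x) by exists 1; rewrite ?mul1r.
have := angle_mul ct1 (angle_atan (d x) (Lc _ Lx)).
have ht := cos2Dsin2 (t x).
have -> : cos (t x) * c x - sin (t x) * d x = u x * (cos (t x) ^+ 2 + sin (t x) ^+ 2).
  by rewrite /c /d; ring.
have -> : cos (t x) * d x + sin (t x) * c x = v x * (cos (t x) ^+ 2 + sin (t x) ^+ 2).
  by rewrite /c /d; ring.
by rewrite ht !mulr1.
Qed.

(** Mayer-Vietoris in degree one, for an intersection with at most one point: the
    two angles differ there by a multiple of [2 pi], by which one of them is
    shifted. *)
Lemma has_angle_glue (R : realType) (X : pseudoMetricType R) (u v : X -> R)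
    (A B : set X) : closed A -> closed B -> compact (A `|` B) ->
    has_angle u v A -> has_angle u v B ->
    (forall x y, A x -> B x -> A y -> B y -> x = y) ->
  has_angle u v (A `|` B).
Proof.
move=> cA cB cAB [s cs As] [t ct Bt] AB1.
have [c [c1 c0 cE]] : exists c, [/\ cos c = 1, sin c = 0 &
    forall x, A x -> B x -> s x = t x + c].
  have [[z [Az Bz]]|nz] := pselect (exists z, A z /\ B z).
    have [c1 c0] := angle_diff (As _ Az) (Bt _ Bz).
    by exists (s z - t z); split => // x Ax Bx; rewrite (AB1 x z)//; lra.
  by exists 0; rewrite cos0 sin0; split => // x Ax Bx; case: nz; exists x.
have ctc : continuous (fun x => t x + c) by cont.
have [h ch [hA hB]] := glue_extension cA cB cAB (continuous_subspaceT cs)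
  (continuous_subspaceT ctc) cE.
exists h => // x [Ax|Bx]; first by rewrite hA//; exact: As.
by rewrite hB//; apply: angle_turn => //; exact: Bt.
Qed.

(** Multiplication by [i] moves any nonzero vector to the right half plane. *)
Lemma angle_exists (R : realType) (a b : R) : a ^+ 2 + b ^+ 2 != 0 ->
  exists t, angle_of a b t.
Proof.
have pos c d : 0 < c -> exists t : R, angle_of c d t.
  by move=> c0; exists (atan (d / c)); exact: angle_atan.
have turn c d : (exists t, angle_of c d t) -> exists t : R, angle_of (- d) c t.
  have h : angle_of (0 : R) 1 (pi / 2).
    by exists 1; rewrite ?cos_pihalf ?sin_pihalf ?mulr0 ?mulr1.
  move=> [t ct]; exists (pi / 2 + t); have := angle_mul h ct.
  by rewrite !mul0r !mul1r !add0r.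
move=> ab; have [a0|a0|a0] := ltgtP a 0.
- have na0 : 0 < - a by rewrite oppr_gt0.
  by have := turn _ _ (turn _ _ (pos _ (- b) na0)); rewrite !opprK.
- exact: pos.
- have [b0|b0|b0] := ltgtP b 0.
  + have nb0 : 0 < - b by rewrite oppr_gt0.
    by have := turn _ _ (turn _ _ (turn _ _ (pos _ 0 nb0))); rewrite !opprK a0.
  + by have := turn _ _ (pos _ 0 b0); rewrite oppr0 a0.
  + by move: ab; rewrite a0 b0 !expr0n addr0 eqxx.
Qed.

Lemma has_angle_subsingleton (R : realType) (T : topologicalType) (u v : T -> R)
    (K : set T) : (forall x y, K x -> K y -> x = y) ->
  (forall x, K x -> u x ^+ 2 + v x ^+ 2 != 0) -> has_angle u v K.
Proof.
move=> K1 uv; have [[z Kz]|nK] := pselect (exists z, K z).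
  have [t zt] := angle_exists (uv _ Kz).
  by exists (fun=> t); [exact: cont_cst|move=> x Kx; rewrite (K1 x z)].
by exists (fun=> 0); [exact: cont_cst|move=> x Kx; case: nK; exists x].
Qed.

(** * Radial transport on a ball *)

Section radial.
Context {R : realType} {V : normedModType R}.

(** Heine's theorem, as a statement about all small enough [d], so that finitely
    many functions can be treated at once. *)
Lemma near_uniform (W : set V) (g : V -> R) (e : R) : compact W -> continuous g -> 0 < e ->
  \forall d \near 0^'+, forall x, W x -> forall y, `|x - y| < d -> `|g x - g y| < e.
Proof.
move=> /compact_near_coveringP cW cg e0.
apply: (cW _ _ (fun d x => forall y, `|x - y| < d -> `|g x - g y| < e)) => x Wx.
have e20 : 0 < e / 2 by rewrite divr_gt0.
have /cvgrPdist_lt /(_ _ e20) /nbhs_normP[r /= r0 xr] := cg x.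
exists (ball x (r / 2), [set d | d < r / 2]) => /=.
  split; first by apply: nbhsx_ballx; rewrite divr_gt0.
  by apply: nbhs_right_lt; rewrite divr_gt0.
move=> [x' d] /= []; rewrite -ball_normE /ball_/= => xx' dr y x'y.
have h1 : `|g x - g x'| < e / 2 by apply: xr => /=; lra.
have h2 : `|g x - g y| < e / 2.
  apply: xr => /=; rewrite -(subrK x' x) -addrA.
  by apply: (le_lt_trans (ler_normD _ _)); lra.
rewrite -(subrK (g x) (g x')) -addrA (le_lt_trans (ler_normD _ _))// (distrC (g x')); lra.
Qed.

(** The retraction onto the ball of radius [M]: composing with it turns what is
    known on the ball into statements about everywhere defined functions. *)
Definition clamp (M : R) (x : V) : V := (M / Num.max M `|x|) *: x.

Lemma clamp_id M x : 0 < M -> `|x| <= M -> clamp M x = x.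
Proof. by move=> M0 xM; rewrite /clamp max_l// divff ?scale1r// gt_eqF. Qed.

Lemma norm_clamp M x : 0 < M -> `|clamp M x| <= M.
Proof.
move=> M0; have m0 : 0 < Num.max M `|x| by rewrite lt_max M0.
rewrite /clamp normrZ gtr0_norm ?divr_gt0// mulrAC ler_pdivrMr// ler_pM2l//.
by rewrite le_max lexx orbT.
Qed.

Lemma cont_clamp M : 0 < M -> continuous (clamp M).
Proof.
move=> M0 x; apply: cvgZ; last exact: cvg_id.
suff : continuous (fun x : V => M / Num.max M `|x|) by exact.
apply: cont_mul; first exact: cont_cst.
apply: cont_inv => [y|]; first by rewrite gt_eqF// lt_max M0.
by apply: cont_max; [exact: cont_cst|exact: norm_continuous].
Qed.

(** The [k]-th of the [N + 1] equally spaced stations on the way from the centre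
    of the ball to a point. *)
Definition station (M : R) (N k : nat) (x : V) : V := (k%:R / N%:R) *: clamp M x.

Lemma station0 M N x : station M N 0 x = 0.
Proof. by rewrite /station mul0r scale0r. Qed.

Lemma station_last M N x : (0 < N)%N -> 0 < M -> `|x| <= M -> station M N N x = x.
Proof.
by move=> N0 M0 xM; rewrite /station divff ?pnatr_eq0 -?lt0n// scale1r clamp_id.
Qed.

Lemma cont_station M N k : 0 < M -> continuous (station M N k).
Proof. by move=> M0 x; apply: cvgZl_tmp; exact: cont_clamp. Qed.

Lemma norm_station M N k x : 0 < M -> (0 < N)%N -> (k <= N)%N -> `|station M N k x| <= M.
Proof.
move=> M0 N0 kN; rewrite normrZ ger0_norm ?divr_ge0// (le_trans _ (norm_clamp x M0))//.
by rewrite ler_piMl// ler_pdivrMr ?ltr0n// mul1r ler_nat.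
Qed.

Lemma radial_steps (I : finType) (g : I -> V -> R) (M e : R) : 0 < M ->
  compact [set x : V | `|x| <= M] -> (forall i, continuous (g i)) -> 0 < e ->
  exists2 N, (0 < N)%N & forall k i x, (k < N)%N ->
    `|g i (station M N k.+1 x) - g i (station M N k x)| < e.
Proof.
move=> M0 cW cg e0.
have : \forall d \near 0^'+, forall i x, `|x| <= M -> forall y, `|x - y| < d ->
    `|g i x - g i y| < e.
  by apply: filter_forall => i; exact: (near_uniform cW (cg i) e0).
move=> /(filterI (nbhs_right_gt 0)) /filter_ex[d [/= d0 dP]].
exists (Num.bound (M / d)).+1 => // k i x kN.
set N := (Num.bound _).+1.
have N0 : 0 < N%:R :> R by rewrite ltr0n.
apply: dP; first exact: norm_station.
rewrite -scalerBl -mulrBl -natrB// subSnn mul1r normrZ gtr0_norm ?invr_gt0//.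
rewrite mulrC ltr_pdivrMr// (le_lt_trans (norm_clamp x M0))// mulrC -ltr_pdivrMr//.
rewrite (lt_le_trans (archi_boundP _)) ?divr_ge0 ?(ltW d0) ?(ltW M0)//.
by rewrite ler_nat.
Qed.

(** A ball is contractible, hence carries no monodromy: the angle is followed from
    the centre outwards, in steps during which the value [u + i v] turns by less
    than a right angle, so that the increment is an arctangent. *)
Lemma has_angle_ball (M : R) (u v : V -> R) : compact [set x : V | `|x| <= M] -> 0 < M ->
  continuous u -> continuous v ->
  (forall x, `|x| <= M -> u x ^+ 2 + v x ^+ 2 != 0) ->
  has_angle u v [set x | `|x| <= M].
Proof.
move=> cW M0 cu cv uv.
have cuv : continuous (fun x => u x ^+ 2 + v x ^+ 2) by cont.
have [|c cM cmin] := compact_EVT_min _ cW (continuous_subspaceT cuv).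
  by exists 0; rewrite /= normr0 ltW.
move: cM; rewrite inE => /= /uv.
set m := u c ^+ 2 + v c ^+ 2 in cmin * => m0.
have {}m0 : 0 < m by rewrite lt_neqAle eq_sym m0 addr_ge0 ?sqr_ge0.
have {}cmin x : `|x| <= M -> m <= u x ^+ 2 + v x ^+ 2.
  by move=> xM; apply: cmin; rewrite inE.
(* a displacement with both coordinates below e is too short to reverse the sign
   of the inner product of two vectors of squared length at least m *)
pose e := Num.min 1 m / 2.
have mm0 : 0 < Num.min 1 m by rewrite lt_min ltr01 m0.
have e0 : 0 < e by rewrite divr_gt0.
have e2 : e ^+ 2 < m / 2.
  have e1 : e < 1 by rewrite ltr_pdivrMr// (@le_lt_trans _ _ 1)// ?ge_min ?lexx//; lra.
  have em : e <= m / 2 by rewrite ler_pM2r// ge_min lexx orbT.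
  by rewrite expr2 (lt_le_trans _ em)// gtr_pMl.
have [|N N0 Nstep] := radial_steps (I := bool) (g := fun b => if b then u else v) M0 cW _ e0.
  by case.
have uv0 : u 0 ^+ 2 + v 0 ^+ 2 != 0 by apply: uv; rewrite normr0 ltW.
have [t0 t0E] := angle_exists uv0.
pose sc := station M N : nat -> V -> V.
have csc k : continuous (sc k) by exact: cont_station.
have scM k x : (k <= N)%N -> `|sc k x| <= M by exact: norm_station.
have step k : (k <= N)%N -> exists2 t : V -> R, continuous t &
    forall x, angle_of (u (sc k x)) (v (sc k x)) (t x).
  elim: k => [_|k IH kN].
    exists (fun=> t0); first exact: cont_cst.
    by move=> x; rewrite /sc station0.
  have [s cs sE] := IH (ltnW kN).
  have cu0 := cont_comp cu (csc k); have cv0 := cont_comp cv (csc k).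
  have cu1 := cont_comp cu (csc k.+1); have cv1 := cont_comp cv (csc k.+1).
  (* a + i b is the quotient of consecutive values, up to a positive factor *)
  pose a x := u (sc k x) * u (sc k.+1 x) + v (sc k x) * v (sc k.+1 x).
  pose b x := u (sc k x) * v (sc k.+1 x) - v (sc k x) * u (sc k.+1 x).
  have ca : continuous a by rewrite /a; cont.
  have cb : continuous b by rewrite /b; cont.
  have a0 x : 0 < a x.
    have := Nstep k true x kN; have := Nstep k false x kN.
    rewrite -/(sc k x) -/(sc k.+1 x) /= !ltr_norml => /andP[h1 h2] /andP[h3 h4].
    have := cmin _ (scM _ x kN); have := cmin _ (scM _ x (ltnW kN)).
    rewrite /a; nra.
  exists (fun x => s x + atan (b x / a x)).
    cont; apply: cont_inv => // x; exact: lt0r_neq0.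
  move=> x; have := angle_mul (sE x) (angle_atan (b x) (a0 x)).
  set q := u (sc k x) ^+ 2 + v (sc k x) ^+ 2.
  have q0 : 0 < q by rewrite (lt_le_trans m0)// cmin// scM// ltnW.
  have -> : u (sc k x) * a x - v (sc k x) * b x = q * u (sc k.+1 x) by rewrite /a /b /q; ring.
  have -> : u (sc k x) * b x + v (sc k x) * a x = q * v (sc k.+1 x) by rewrite /a /b /q; ring.
  move=> /(angle_scale (r := q^-1)); rewrite invr_gt0 => /(_ q0).
  by rewrite !mulrA mulVf ?mul1r// gt_eqF.
have [s cs sE] := step N (leqnn N).
by exists s => // x xM; have := sE x; rewrite /sc station_last.
Qed.

(** The same contractibility one dimension higher: a continuous family of
    subspaces (the ranges of the projectors [P x]) over a ball has a nowhere
    vanishing section, obtained by projecting a vector of the central fibre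
    successively along each ray; no vector dies, for the projectors of consecutive
    stations are close. *)
Lemma projector_section (M : R) m (P : V -> 'M[R]_m) (w0 : 'rV[R]_m) :
  compact [set x : V | `|x| <= M] -> 0 < M ->
  (forall i j, continuous (fun x => P x i j)) ->
  (forall x, `|x| <= M -> P x *m P x = P x) -> w0 != 0 -> w0 *m P 0 = w0 ->
  exists2 w : V -> 'rV[R]_m, (forall i, continuous (fun x => w x 0 i)) &
    forall x, `|x| <= M -> w x *m P x = w x /\ w x != 0.
Proof.
move=> cW M0 cP PP w00 w0P.
have m0 : 0 < m.+1%:R^-1 :> R by rewrite invr_gt0.
have [|N N0 Nstep] := radial_steps (I := ('I_m * 'I_m)%type)
    (g := fun ij x => P x ij.1 ij.2) M0 cW _ m0.
  by move=> [i j]; exact: cP.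
pose sc := station M N : nat -> V -> V.
have csc k : continuous (sc k) by exact: cont_station.
have scM k x : (k <= N)%N -> `|sc k x| <= M by exact: norm_station.
have step k : (k <= N)%N -> exists2 w : V -> 'rV[R]_m,
    (forall i, continuous (fun x => w x 0 i)) &
    forall x, w x *m P (sc k x) = w x /\ w x != 0.
  elim: k => [_|k IH kN].
    by exists (fun=> w0) => [i|x]; [exact: cont_cst|rewrite /sc station0].
  have [w cw wP] := IH (ltnW kN).
  exists (fun x => w x *m P (sc k.+1 x)) => [i|x].
    rewrite (_ : (fun _ => _) = fun x => \sum_j w x 0 j * P (sc k.+1 x) j i); last first.
      by apply/funext => x; rewrite mxE.
    apply: cont_sum => j; apply: cont_mul; first exact: cw.
    exact: (cont_comp (cP j i) (csc k.+1)).
  split; first by rewrite -mulmxA PP// scM.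
  have [wPx wx0] := wP x; apply/eqP => wP0.
  pose D := P (sc k.+1 x) - P (sc k x).
  have wD : w x *m D = - w x by rewrite mulmxBr wP0 wPx sub0r.
  have DE i j : `|D i j| < m.+1%:R^-1.
    by rewrite !mxE; exact: (Nstep k (i, j) x).
  (* in the sum norm, multiplication by D shrinks w by the factor m / (m + 1) *)
  pose S := \sum_j `|w x 0 j|.
  have S0 : 0 < S.
    rewrite lt_neqAle sumr_ge0// andbT eq_sym; apply: contra wx0.
    rewrite psumr_eq0// => /allP w0'; apply/eqP/rowP => j; rewrite mxE.
    by apply/eqP; rewrite -normr_eq0; apply: w0'; rewrite mem_index_enum.
  suff : S <= S * (m%:R * m.+1%:R^-1).
    rewrite leNgt gtr_pMr// ltr_pdivrMr ?ltr0n// mul1r ltr_nat ltnSn//.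
  have Sj (j : 'I_m) : `|w x 0 j| <= S * m.+1%:R^-1.
    have := congr1 (fun A : 'rV[R]_m => A 0 j) wD; rewrite /= !mxE => wj.
    rewrite -normrN -wj (le_trans (ler_norm_sum _ _ _))// /S mulr_suml.
    by apply: ler_sum => i _; rewrite normrM ler_wpM2l// ltW.
  rewrite {1}/S (le_trans (ler_sum _ (fun j _ => Sj j)))//.
  by rewrite sumr_const card_ord -mulrnAr -mulr_natl.
have [w cw wP] := step N (leqnn N).
by exists w => // x xM; have := wP x; rewrite /sc station_last.
Qed.

End radial.

(** * Separation of the plane *)

Lemma cont_rV (R : realType) (T : topologicalType) n (f : T -> 'rV[R]_n) :
  (forall i, continuous (fun x => f x 0 i)) -> continuous f.
Proof.
move=> cf x A [P nP sPA]; apply: (@filterS _ _ _ (fun y => forall i j, P i j (f y i j))).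
  by move=> y Py; exact: sPA.
apply: filter_forall => i; apply: filter_forall => j; rewrite (ord1 i).
by apply: cf; exact: nP.
Qed.

Lemma compact_ball_rV (R : realType) n (M : R) : compact [set x : 'rV[R]_n | `|x| <= M].
Proof.
apply: bounded_closed_compact.
  exists M; split; first exact: num_real.
  by move=> k Mk x /= xM; rewrite (le_trans xM)// ltW.
apply: (@preimage_closed _ _ (fun x : 'rV[R]_n => `|x|) [set y | y <= M]); last exact: closed_le.
by move=> x _; exact: norm_continuous.
Qed.

Lemma coord_norm_rV (R : realType) n (x : 'rV[R]_n) i : `|x 0 i| <= `|x|.
Proof.
rewrite [leRHS]/Num.norm /= mx_normrE; apply/bigmax_geP; right => /=.
by exists (0, i).
Qed.

Lemma norm_rV_le (R : realType) n (x : 'rV[R]_n) M : 0 <= M ->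
  (forall i, `|x 0 i| <= M) -> `|x| <= M.
Proof.
move=> M0 xM; rewrite [leLHS]/Num.norm /= mx_normrE; apply/bigmax_leP; split => // -[i j] _ /=.
by rewrite ord1.
Qed.

Lemma rV2_norm_gt0 (R : realType) (x : 'rV[R]_2) : x != 0 -> 0 < x 0 0 ^+ 2 + x 0 1 ^+ 2.
Proof.
move=> x0; rewrite lt_neqAle addr_ge0 ?sqr_ge0// andbT eq_sym.
apply: contra x0; rewrite paddr_eq0 ?sqr_ge0// !sqrf_eq0 => /andP[/eqP h0 /eqP h1].
apply/eqP/rowP => i; rewrite mxE.
by case: i => -[|[|//]] p; [rewrite -[RHS]h0|rewrite -[RHS]h1]; congr (x _ _); exact: val_inj.
Qed.

(** The sphere of the sup norm is used, so that it bounds the ball of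
    [has_angle_ball]; it is parametrized by the polar angle [s], and an angle [t]
    would make [t - s] a continuous function with values in the multiples of [2 pi]
    that drops by [2 pi] in one turn. *)
Lemma no_angle_around_origin (R : realType) (M : R) : 0 < M ->
  ~ has_angle (fun x : 'rV[R]_2 => x 0 0) (fun x => x 0 1) [set x | `|x| = M].
Proof.
move=> M0 [t ct tE].
pose w (s : R) : 'rV[R]_2 := \row_i (if i == 0 then cos s else sin s).
have w0 s : w s != 0.
  apply/eqP => /rowP ws; have := cos2Dsin2 s.
  have := ws 0; have := ws 1; rewrite !mxE /= => -> ->.
  by rewrite expr0n addr0 => /eqP; rewrite eq_sym oner_eq0.
have nw0 s : 0 < `|w s| by rewrite normr_gt0.
have cw : continuous w.
  apply: cont_rV => i; have [->|i0] := eqVneq i 0.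
    rewrite (_ : (fun _ => _) = cos); first exact: continuous_cos.
    by apply/funext => x; rewrite mxE.
  rewrite (_ : (fun _ => _) = sin); first exact: continuous_sin.
  by apply/funext => x; rewrite mxE (negbTE i0).
pose z s := (M / `|w s|) *: w s.
have cz : continuous z.
  move=> s; apply: cvgZ; last exact: cw.
  suff : continuous (fun s => M / `|w s|) by exact.
  apply: cont_mul; first exact: cont_cst.
  apply: cont_inv => [s'|]; first by rewrite gt_eqF.
  by apply: cont_comp cw; exact: norm_continuous.
pose h s := t (z s) - s.
have ch : continuous h.
  by apply: cont_add; [exact: cont_comp cz|apply: cont_opp => s; exact: cvg_id].
have zE s : angle_of (z s 0 0) (z s 0 1) (t (z s)).
  apply: tE => /=; rewrite /z normrZ gtr0_norm ?divr_gt0// divfK// gt_eqF//.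
have h1 s : cos (h s) = 1.
  have : angle_of (z s 0 0) (z s 0 1) s.
    by exists (M / `|w s|); rewrite ?divr_gt0// !mxE.
  by move=> /(angle_diff (zE s)) [].
have hper : h (pi *+ 2) = h 0 - pi *+ 2.
  rewrite /h subr0; congr (t _ - _).
  suff wE : w (pi *+ 2) = w 0 by rewrite /z wE.
  by apply/rowP => i; rewrite !mxE cos2pi sin2pi cos0 sin0.
have pi20 : 0 <= pi *+ 2 :> R by rewrite mulrn_wge0// pi_ge0.
(* halfway through the drop, the cosine would be -1 *)
have [||s _ hs] := @IVT R h 0 (pi *+ 2) (h 0 - pi) pi20.
- exact: continuous_subspaceT.
- have p0 := pi_ge0 R; rewrite hper mulr2n; move: (h 0) => a.
  by rewrite ge_min le_max; apply/andP; split; apply/orP; [right|left]; lra.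
have := h1 s; rewrite hs -[h 0 - pi]addrC.
have := cosDpi (h 0 - pi); rewrite subrK h1 [h 0 - pi]addrC => c1 c2.
by move: c1; rewrite c2 => c1; lra.
Qed.

(** The set [U] is a bounded union of components of the complement of [F]: its
    boundary lies in [F]. *)
Definition encloses_origin (R : realType) n (F : set 'rV[R]_n) :=
  exists (U : set 'rV[R]_n) (M : R), [/\ open U, U 0, U `&` F = set0, closed (U `|` F) &
    forall x, (U `|` F) x -> `|x| < M].

Lemma angle_cos_sin (R : realType) (a b t : R) : angle_of a b t ->
  (cos t = a / Num.sqrt (a ^+ 2 + b ^+ 2)) * (sin t = b / Num.sqrt (a ^+ 2 + b ^+ 2)).
Proof.
move=> [q q0 [-> ->]].
rewrite !exprMn -mulrDr cos2Dsin2 mulr1 sqrtr_sqr gtr0_norm//.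
by split; rewrite mulrC mulKf// gt_eqF.
Qed.

(** Borsuk's criterion in the plane: an angle [t] on [F] would extend to the enclosed
    region, and the unit vector that is [exp (i t)] there and [x / |x|] outside would
    be continuous on a large disc, hence have an angle there, even on its boundary. *)
Lemma enclosing_curve_no_angle (R : realType) (F : set 'rV[R]_2) :
  compact F -> encloses_origin F -> ~ has_angle (fun x : 'rV[R]_2 => x 0 0) (fun x => x 0 1) F.
Proof.
move=> cF [U [M [oU U0 UF0 cUF UFM]]] [t ct tE].
have M0 : 0 < M by rewrite -(normr0 'rV[R]_2) UFM//; left.
have clF : closed F by apply: compact_closed => //; exact: norm_hausdorff.
pose W := [set x : 'rV[R]_2 | `|x| <= M].
have cW : compact W := @compact_ball_rV R 2 M.
have clW : closed W by apply: compact_closed => //; exact: norm_hausdorff.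
pose Q := W `&` ~` U.
have clQ : closed Q by apply: closedI => //; exact: open_closedC.
have WE : (U `|` F) `|` Q = W.
  apply/seteqP; split => [x [/UFM/ltW//|[]//]|x Wx].
  by have [Ux|nUx] := pselect (U x); [left; left|right].
have Q0 x : Q x -> x != 0 by move=> [_ nUx]; apply/eqP => x0; apply: nUx; rewrite x0.
pose r (x : 'rV[R]_2) := Num.sqrt (x 0 0 ^+ 2 + x 0 1 ^+ 2).
have r0 x : x != 0 -> 0 < r x by move=> /rV2_norm_gt0; rewrite sqrtr_gt0.
have cx i : continuous (fun x : 'rV[R]_2 => x 0 i) by exact: coord_continuous.
have cr : continuous r by rewrite /r; cont.
have cq i : {within Q, continuous (fun x => x 0 i / r x)}.
  apply: cont_mul; first exact: continuous_subspaceT.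
  apply: cont_inv_within; last exact: continuous_subspaceT.
  by move=> x /Q0/r0; exact: lt0r_neq0.
have FQ x : (U `|` F) x -> Q x -> (cos (t x) = x 0 0 / r x) * (sin (t x) = x 0 1 / r x).
  move=> [Ux [_ /(_ Ux)]//|Fx /Q0 x0].
  by have [-> ->] := angle_cos_sin (tE _ Fx).
have cUFQ : compact ((U `|` F) `|` Q) by rewrite WE.
have ctc : continuous (fun x => cos (t x)) by cont.
have cts : continuous (fun x => sin (t x)) by cont.
have [a ca [aU aQ]] := glue_extension cUF clQ cUFQ (continuous_subspaceT ctc) (cq 0)
  (fun x Px Qx => (FQ x Px Qx).1).
have [b cb [bU bQ]] := glue_extension cUF clQ cUFQ (continuous_subspaceT cts) (cq 1)
  (fun x Px Qx => (FQ x Px Qx).2).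
have [x|s cs sE] := has_angle_ball cW M0 ca cb.
  move=> xM; have : W x by [].
  rewrite -WE => -[Px|Qx]; first by rewrite aU// bU// cos2Dsin2 oner_eq0.
  have rx := r0 _ (Q0 _ Qx); have zx := rV2_norm_gt0 (Q0 _ Qx).
  by rewrite aQ// bQ// !exprMn -mulrDl mulf_neq0 ?expf_neq0 ?invr_eq0 ?gt_eqF.
apply: (no_angle_around_origin M0); exists s => // x xM.
have Qx : Q x.
  split; first by rewrite /W /= xM.
  by move=> Ux; have := UFM x (or_introl Ux); rewrite xM ltxx.
have := sE x; rewrite /= xM => /(_ (lexx _)) /(angle_scale (r0 _ (Q0 _ Qx))).
by rewrite aQ// bQ// ![r x * (_ / _)]mulrC !divfK// gt_eqF// r0// Q0.
Qed.

(** * Lifting through the Hopf map *)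

Section hopf.
Context {R : realType}.
Implicit Types (x : 'rV[R]_3) (a b c d p q r : R).

Lemma rV3_eq0 x : x 0 0 = 0 -> x 0 1 = 0 -> x 0 2 = 0 -> x = 0.
Proof.
move=> h0 h1 h2; apply/rowP => i; rewrite mxE.
by case: i => -[|[|[|//]]] k; [rewrite -[RHS]h0|rewrite -[RHS]h1|rewrite -[RHS]h2];
  congr (x _ _); exact: val_inj.
Qed.

Definition radius x : R := Num.sqrt (x 0 0 ^+ 2 + x 0 1 ^+ 2 + x 0 2 ^+ 2).

Lemma radius_sqr x : radius x ^+ 2 = x 0 0 ^+ 2 + x 0 1 ^+ 2 + x 0 2 ^+ 2.
Proof. by rewrite sqr_sqrtr// !addr_ge0 ?sqr_ge0. Qed.

Lemma radius_gt0 x : x != 0 -> 0 < radius x.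
Proof.
move=> x0; rewrite sqrtr_gt0 lt_neqAle !addr_ge0 ?sqr_ge0// andbT eq_sym.
apply: contra x0; rewrite !paddr_eq0 ?addr_ge0 ?sqr_ge0// !sqrf_eq0.
by move=> /andP[/andP[/eqP h0 /eqP h1] /eqP h2]; apply/eqP/rV3_eq0.
Qed.

Lemma cont_radius : continuous radius.
Proof.
have cx i : continuous (fun x : 'rV[R]_3 => x 0 i) by exact: coord_continuous.
by rewrite /radius; cont.
Qed.

(** The spinor [(w, w') = (a + i b, c + i d)] lies over [x] for the Hopf map from C^2
    to R^3, with coordinates twice the complex number [w * conj w'] and
    [|w|^2 - |w'|^2]. *)
Definition hopf_lift x a b c d := [/\ x 0 0 = 2 * (a * c + b * d),
  x 0 1 = 2 * (b * c - a * d) & x 0 2 = a ^+ 2 + b ^+ 2 - c ^+ 2 - d ^+ 2].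

Definition sqn a b c d := a ^+ 2 + b ^+ 2 + c ^+ 2 + d ^+ 2.

Lemma hopf_lift_radius x a b c d : hopf_lift x a b c d -> radius x = sqn a b c d.
Proof.
move=> [x0 x1 x2]; rewrite /radius x0 x1 x2.
rewrite (_ : _ + _ = sqn a b c d ^+ 2); last by rewrite /sqn; ring.
by rewrite sqrtr_sqr ger0_norm// !addr_ge0 ?sqr_ge0.
Qed.

Lemma hopf_lift_rotate x a b c d p q : p ^+ 2 + q ^+ 2 = 1 -> hopf_lift x a b c d ->
  hopf_lift x (a * p - b * q) (b * p + a * q) (c * p - d * q) (d * p + c * q).
Proof.
move=> pq [x0 x1 x2]; split.
- rewrite x0 -[LHS]mulr1 -pq; ring.
- rewrite x1 -[LHS]mulr1 -pq; ring.
- rewrite x2 -[LHS]mulr1 -pq; ring.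
Qed.

(** Real and imaginary parts of the hermitian product of two spinors. *)
Definition hre a b c d a' b' c' d' := a * a' + b * b' + c * c' + d * d'.
Definition him a b c d a' b' c' d' := b * a' - a * b' + d * c' - c * d'.

(** Two spinors over [x] differ by a phase: their hermitian product [p + i q],
    divided by their common squared length [radius x]. *)
Lemma hopf_lift_ratio x a b c d a' b' c' d' (p := hre a b c d a' b' c' d')
    (q := him a b c d a' b' c' d') :
  hopf_lift x a b c d -> hopf_lift x a' b' c' d' ->
  [/\ p ^+ 2 + q ^+ 2 = radius x ^+ 2,
   a' * p - b' * q = radius x * a, b' * p + a' * q = radius x * b &
   c' * p - d' * q = radius x * c /\ d' * p + c' * q = radius x * d].
Proof.
move=> h h'; have rE := hopf_lift_radius h; have rE' := hopf_lift_radius h'.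
have [x0 x1 x2] := h; have [y0 y1 y2] := h'.
have E1 : a * c + b * d = a' * c' + b' * d' by lra.
have E2 : b * c - a * d = b' * c' - a' * d' by lra.
have E3 : a ^+ 2 + b ^+ 2 = a' ^+ 2 + b' ^+ 2 by move: rE rE'; rewrite /sqn; lra.
have E4 : c ^+ 2 + d ^+ 2 = c' ^+ 2 + d' ^+ 2 by move: rE rE'; rewrite /sqn; lra.
have e1 : a' * p - b' * q = radius x * a.
  transitivity (a * (a' ^+ 2 + b' ^+ 2) + c * (a' * c' + b' * d') - d * (b' * c' - a' * d')).
    by rewrite /p /q /hre /him; ring.
  by rewrite -E1 -E2 -E3 rE /sqn; ring.
have e2 : b' * p + a' * q = radius x * b.
  transitivity (b * (a' ^+ 2 + b' ^+ 2) + d * (a' * c' + b' * d') + c * (b' * c' - a' * d')).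
    by rewrite /p /q /hre /him; ring.
  by rewrite -E1 -E2 -E3 rE /sqn; ring.
have e3 : c' * p - d' * q = radius x * c.
  transitivity (c * (c' ^+ 2 + d' ^+ 2) + a * (a' * c' + b' * d') + b * (b' * c' - a' * d')).
    by rewrite /p /q /hre /him; ring.
  by rewrite -E1 -E2 -E4 rE /sqn; ring.
have e4 : d' * p + c' * q = radius x * d.
  transitivity (d * (c' ^+ 2 + d' ^+ 2) + b * (a' * c' + b' * d') - a * (b' * c' - a' * d')).
    by rewrite /p /q /hre /him; ring.
  by rewrite -E1 -E2 -E4 rE /sqn; ring.
split => //.
have -> : p = hre a b c d a' b' c' d' by [].
have r4 : (p ^+ 2 + q ^+ 2) * radius x = radius x ^+ 2 * radius x.
  transitivity ((a' * p - b' * q) ^+ 2 + (b' * p + a' * q) ^+ 2 +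
      (c' * p - d' * q) ^+ 2 + (d' * p + c' * q) ^+ 2).
    by rewrite rE' /sqn; ring.
  by rewrite e1 e2 e3 e4 [in X in _ = _ * X]rE /sqn; ring.
have [r0|r0] := eqVneq (radius x) 0; last exact: (mulIf r0).
have s0 : sqn a b c d = 0 by rewrite -rE.
move: s0; rewrite /sqn => s0.
have := sqr_ge0 a; have := sqr_ge0 b; have := sqr_ge0 c; have := sqr_ge0 d => ????.
have /eqP : a ^+ 2 = 0 by lra.
have /eqP : b ^+ 2 = 0 by lra.
have /eqP : c ^+ 2 = 0 by lra.
have /eqP : d ^+ 2 = 0 by lra.
rewrite !sqrf_eq0 => /eqP d0 /eqP c0 /eqP b0 /eqP a0.
by rewrite /p /q /hre /him a0 b0 c0 d0 r0; ring.
Qed.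

(** The complex line spanned by the spinors over [x], described linearly: it is the
    eigenspace of the Pauli matrix of [x] for the eigenvalue [radius x]. *)
Definition eigenspinor x a b c d := [/\ radius x * a = x 0 2 * a + x 0 0 * c - x 0 1 * d,
  radius x * b = x 0 2 * b + x 0 0 * d + x 0 1 * c,
  radius x * c = x 0 0 * a + x 0 1 * b - x 0 2 * c &
  radius x * d = x 0 0 * b - x 0 1 * a - x 0 2 * d].

Lemma hopf_lift_eigen x a b c d : hopf_lift x a b c d -> eigenspinor x a b c d.
Proof.
move=> h; have [x0 x1 x2] := h.
by rewrite /eigenspinor (hopf_lift_radius h) x0 x1 x2 /sqn; split; ring.
Qed.

(** An eigenspinor lies over a positive multiple of [x], so only its length has to
    be adjusted. *)
Lemma eigen_hopf_lift x a b c d (k := Num.sqrt (radius x / sqn a b c d)) :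
  x != 0 -> sqn a b c d != 0 -> eigenspinor x a b c d ->
  hopf_lift x (k * a) (k * b) (k * c) (k * d).
Proof.
move=> /radius_gt0 r0 n0 [ea eb ec ed].
have r0' := lt0r_neq0 r0.
have nn : 0 < sqn a b c d by rewrite lt_neqAle eq_sym n0 !addr_ge0 ?sqr_ge0.
have kE : k ^+ 2 = radius x / sqn a b c d by rewrite sqr_sqrtr// divr_ge0// ltW.
have sc y z : radius x * y = sqn a b c d * z -> z = k ^+ 2 * y.
  by move=> yz; rewrite kE mulrAC yz mulrAC divff// mul1r.
split.
- rewrite (sc (2 * (a * c + b * d)) (x 0 0)); first ring.
  transitivity ((radius x * a) * c + a * (radius x * c) + (radius x * b) * d +
    b * (radius x * d)); first ring.
  by rewrite ea eb ec ed /sqn; ring.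
- rewrite (sc (2 * (b * c - a * d)) (x 0 1)); first ring.
  transitivity ((radius x * b) * c + b * (radius x * c) - (radius x * a) * d -
    a * (radius x * d)); first ring.
  by rewrite ea eb ec ed /sqn; ring.
- rewrite (sc (a ^+ 2 + b ^+ 2 - c ^+ 2 - d ^+ 2) (x 0 2)); first ring.
  transitivity ((radius x * a) * a + (radius x * b) * b - (radius x * c) * c -
    (radius x * d) * d); first ring.
  by rewrite ea eb ec ed /sqn; ring.
Qed.

(** The components of the image of a spinor under [radius x] plus the Pauli matrix of
    [x], which is [2 * radius x] times the orthogonal projection onto the eigenline. *)
Definition pr1 x a b c d := (radius x + x 0 2) * a + x 0 0 * c - x 0 1 * d.
Definition pr2 x a b c d := (radius x + x 0 2) * b + x 0 0 * d + x 0 1 * c.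
Definition pr3 x a b c d := x 0 0 * a + x 0 1 * b + (radius x - x 0 2) * c.
Definition pr4 x a b c d := x 0 0 * b - x 0 1 * a + (radius x - x 0 2) * d.

Lemma eigenspinor_proj x a b c d : eigenspinor x (pr1 x a b c d) (pr2 x a b c d)
  (pr3 x a b c d) (pr4 x a b c d).
Proof.
have r2 := radius_sqr x; rewrite /eigenspinor /pr1 /pr2 /pr3 /pr4.
by split; apply/eqP; rewrite -subr_eq0; apply/eqP;
  [transitivity ((radius x ^+ 2 - (x 0 0 ^+ 2 + x 0 1 ^+ 2 + x 0 2 ^+ 2)) * a)
  |transitivity ((radius x ^+ 2 - (x 0 0 ^+ 2 + x 0 1 ^+ 2 + x 0 2 ^+ 2)) * b)
  |transitivity ((radius x ^+ 2 - (x 0 0 ^+ 2 + x 0 1 ^+ 2 + x 0 2 ^+ 2)) * c)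
  |transitivity ((radius x ^+ 2 - (x 0 0 ^+ 2 + x 0 1 ^+ 2 + x 0 2 ^+ 2)) * d)];
  try ring; rewrite r2 subrr mul0r.
Qed.

(** Off the negative third axis the first basis spinor has a nonzero projection onto
    the eigenline, and on that axis the second one has. *)
Lemma hopf_lift_exists x : exists a b c d, hopf_lift x a b c d.
Proof.
have [->|x0] := eqVneq x 0.
  by exists 0, 0, 0, 0; rewrite /hopf_lift !mxE; split; ring.
have r0 := radius_gt0 x0.
have [a [c n0]] : exists a c,
    sqn (pr1 x a 0 c 0) (pr2 x a 0 c 0) (pr3 x a 0 c 0) (pr4 x a 0 c 0) != 0.
  have [rt|rt] := eqVneq (radius x + x 0 2) 0.
    exists 0, 1; rewrite gt_eqF// /sqn /pr3 (_ : x 0 2 = - radius x); last by lra.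
    rewrite !mulr0 !add0r mulr1 ltr_wpDr ?sqr_ge0// ltr_wpDl ?addr_ge0 ?sqr_ge0//.
    by rewrite exprn_gt0//; lra.
  exists 1, 0; rewrite gt_eqF// /sqn /pr1 !mulr0 subr0 addr0 mulr1.
  by rewrite -!addrA ltr_wpDr ?addr_ge0 ?sqr_ge0// exprn_even_gt0.
have h := eigen_hopf_lift x0 n0 (eigenspinor_proj x a 0 c 0).
by do 4 eexists; exact: h.
Qed.

(** The Hopf line bundle is trivial over [K]. The first Chern class of that bundle
    generates the second cohomology of the space minus the origin. *)
Definition has_lift (K : set 'rV[R]_3) := exists a b c d : 'rV[R]_3 -> R,
  [/\ continuous a, continuous b, continuous c, continuous d &
   forall x, K x -> hopf_lift x (a x) (b x) (c x) (d x)].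

Lemma has_lift_subsingleton (K : set 'rV[R]_3) : (forall x y, K x -> K y -> x = y) ->
  has_lift K.
Proof.
move=> K1; have [[z Kz]|nK] := pselect (exists z, K z).
  have [a [b [c [d zE]]]] := hopf_lift_exists z.
  exists (fun=> a), (fun=> b), (fun=> c), (fun=> d).
  by split; try exact: cont_cst; move=> x Kx; rewrite (K1 x z).
exists (fun=> 0), (fun=> 0), (fun=> 0), (fun=> 0).
by split; try exact: cont_cst; move=> x Kx; case: nK; exists x.
Qed.

Let hE : hausdorff_space 'rV[R]_3 := @norm_hausdorff R 'rV[R]_3.

(** Near [K], the lift given on [K] still has a nonzero projection onto the eigenline,
    which is rescaled to a lift. The origin must be avoided: there the eigenline is
    not defined. *)
Lemma has_lift_open (F : set 'rV[R]_3) : ~ F 0 -> open_on_compacts F has_lift.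
Proof.
move=> F0 K cK KF [a [b [c [d [ca cb cc cd hK]]]]].
have cx i : continuous (fun x : 'rV[R]_3 => x 0 i) by exact: coord_continuous.
have cr := cont_radius.
pose w1 x := pr1 x (a x) (b x) (c x) (d x); pose w2 x := pr2 x (a x) (b x) (c x) (d x).
pose w3 x := pr3 x (a x) (b x) (c x) (d x); pose w4 x := pr4 x (a x) (b x) (c x) (d x).
have c1 : continuous w1 by rewrite /w1 /pr1; cont.
have c2 : continuous w2 by rewrite /w2 /pr2; cont.
have c3 : continuous w3 by rewrite /w3 /pr3; cont.
have c4 : continuous w4 by rewrite /w4 /pr4; cont.
pose n x := sqn (w1 x) (w2 x) (w3 x) (w4 x).
have cn : continuous n by rewrite /n /sqn; cont.
have F0' x : F x -> x != 0 by move=> Fx; apply/eqP => x0; apply: F0; rewrite -x0.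
exists [set x | n x != 0]; split; first exact: open_neq0.
  move=> x Kx /=; have [ea eb ec ed] := hopf_lift_eigen (hK _ Kx).
  have -> : n x = (2 * radius x) ^+ 2 * sqn (a x) (b x) (c x) (d x).
    have e1 : w1 x = 2 * (radius x * a x) by rewrite /w1 /pr1; lra.
    have e2 : w2 x = 2 * (radius x * b x) by rewrite /w2 /pr2; lra.
    have e3 : w3 x = 2 * (radius x * c x) by rewrite /w3 /pr3; lra.
    have e4 : w4 x = 2 * (radius x * d x) by rewrite /w4 /pr4; lra.
    by rewrite /n e1 e2 e3 e4 /sqn; ring.
  rewrite -(hopf_lift_radius (hK _ Kx)); have r0 := radius_gt0 (F0' _ (KF _ Kx)).
  by rewrite mulf_neq0 ?expf_neq0 ?mulf_neq0 ?gt_eqF.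
move=> L cL LF Ln.
have ext (w : 'rV[R]_3 -> R) : continuous w -> exists2 g : 'rV[R]_3 -> R, continuous g &
    forall x, L x -> Num.sqrt (radius x / n x) * w x = g x.
  move=> cw; apply: continuous_extension (compact_closed hE cL) cL _.
  apply: cont_mul; last exact: continuous_subspaceT.
  apply: cont_sqrt; apply: cont_mul; first exact: continuous_subspaceT.
  by apply: cont_inv_within; [exact: Ln|exact: continuous_subspaceT].
have [g1 cg1 g1E] := ext _ c1; have [g2 cg2 g2E] := ext _ c2.
have [g3 cg3 g3E] := ext _ c3; have [g4 cg4 g4E] := ext _ c4.
exists g1, g2, g3, g4; split => // x Lx; rewrite -g1E// -g2E// -g3E// -g4E//.
by apply: eigen_hopf_lift; [exact/F0'/LF|exact: Ln|exact: eigenspinor_proj].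
Qed.

(** Mayer-Vietoris in degree two: lifts over [A] and over [B] differ on the
    intersection by a phase, and if that phase has an angle then, the angle being
    defined everywhere, one lift can be rotated to match the other. *)
Lemma has_lift_glue (A B : set 'rV[R]_3) : closed A -> closed B -> compact (A `|` B) ->
  ~ (A `&` B) 0 -> has_lift A -> has_lift B -> ~ has_lift (A `|` B) ->
  exists u v : 'rV[R]_3 -> R, [/\ continuous u, continuous v,
    forall x, (A `&` B) x -> u x ^+ 2 + v x ^+ 2 != 0 & ~ has_angle u v (A `&` B)].
Proof.
move=> cA cB cAB AB0 [a [b [c [d [ca cb cc cd hA]]]]] [a' [b' [c' [d' [ca' cb' cc' cd' hB]]]]] nl.
pose u x := hre (a x) (b x) (c x) (d x) (a' x) (b' x) (c' x) (d' x).
pose v x := him (a x) (b x) (c x) (d x) (a' x) (b' x) (c' x) (d' x).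
have x0 x : (A `&` B) x -> radius x != 0.
  by move=> ABx; rewrite gt_eqF// radius_gt0//; apply/eqP => x0; apply: AB0; rewrite -x0.
exists u, v; split.
- by rewrite /u /hre; cont.
- by rewrite /v /him; cont.
- move=> x ABx; have [-> _ _ _] := hopf_lift_ratio (hA _ ABx.1) (hB _ ABx.2).
  by rewrite expf_neq0// x0.
move=> [t ct tE]; apply: nl.
have glue (f g h : 'rV[R]_3 -> R) : continuous f -> continuous g -> continuous h ->
    (forall x, (A `&` B) x -> g x * u x + h x * v x = radius x * f x) ->
    exists2 k : 'rV[R]_3 -> R, continuous k & (forall x, A x -> k x = f x) /\
      (forall x, B x -> k x = g x * cos (t x) + h x * sin (t x)).
  move=> cf cg ch fgh; apply: glue_extension => //; try apply: continuous_subspaceT => //.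
    by cont.
  move=> x Ax Bx; have rx := x0 x (conj Ax Bx).
  have [-> ->] := angle_cos_sin (tE x (conj Ax Bx)).
  have [-> _ _ _] := hopf_lift_ratio (hA _ Ax) (hB _ Bx).
  rewrite sqrtr_sqr ger0_norm ?sqrtr_ge0// !mulrA -mulrDl fgh//.
  by rewrite mulrAC divff// mul1r.
have cN (f : 'rV[R]_3 -> R) : continuous f -> continuous (fun x => - f x) by exact: cont_opp.
have rat x (ABx : (A `&` B) x) := hopf_lift_ratio (hA _ ABx.1) (hB _ ABx.2).
have [k1 ck1 [k1A k1B]] := glue a a' (fun x => - b' x) ca ca' (cN _ cb')
  (fun x ABx => ltac:(by rewrite mulNr; have [_ -> _ _] := rat x ABx)).
have [k2 ck2 [k2A k2B]] := glue b b' a' cb cb' ca'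
  (fun x ABx => ltac:(by have [_ _ -> _] := rat x ABx)).
have [k3 ck3 [k3A k3B]] := glue c c' (fun x => - d' x) cc cc' (cN _ cd')
  (fun x ABx => ltac:(by rewrite mulNr; have [_ _ _ [-> _]] := rat x ABx)).
have [k4 ck4 [k4A k4B]] := glue d d' c' cd cd' cc'
  (fun x ABx => ltac:(by have [_ _ _ [_ ->]] := rat x ABx)).
exists k1, k2, k3, k4; split => // x [Ax|Bx].
  by rewrite k1A// k2A// k3A// k4A//; exact: hA.
rewrite k1B// k2B// k3B// k4B// !mulNr; apply: hopf_lift_rotate; last exact: hB.
exact: cos2Dsin2.
Qed.

End hopf.

(** * The field of lines in complex three-space that extends the Hopf lines *)

Section line_projector.
Context {R : realType}.
Implicit Types (x : 'rV[R]_3) (a b c d e : R).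

Lemma sum_ord6 (F : 'I_6 -> R) : \sum_i F i = F 0 + F 1 + F 2 + F 3 + F 4 + F 5.
Proof.
rewrite !big_ord_recr big_ord0 /= add0r.
by congr (F _ + F _ + F _ + F _ + F _ + F _); exact: val_inj.
Qed.

(** The vector [(a + i b, c + i d, e)] of complex three-space in real coordinates,
    and its product by [i]. *)
Definition spinor a b c d e : 'rV[R]_6 := \row_i nth 0 [:: a; b; c; d; e; 0] i.
Definition ispinor a b c d e : 'rV[R]_6 := \row_i nth 0 [:: - b; a; - d; c; 0; e] i.

(** The orthogonal projector onto the complex line of [(a + i b, c + i d, e)], times
    the squared length of that vector. *)
Definition spinor_mx a b c d e : 'M[R]_6 :=
  (spinor a b c d e)^T *m spinor a b c d e + (ispinor a b c d e)^T *m ispinor a b c d e.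

Lemma spinor_dot a b c d e : [/\
  spinor a b c d e *m (spinor a b c d e)^T = (sqn a b c d + e ^+ 2)%:M,
  ispinor a b c d e *m (ispinor a b c d e)^T = (sqn a b c d + e ^+ 2)%:M,
  spinor a b c d e *m (ispinor a b c d e)^T = 0 &
  ispinor a b c d e *m (spinor a b c d e)^T = 0].
Proof.
by split; apply/matrixP => i j; rewrite !ord1 !mxE !big_ord_recr big_ord0 /= !mxE /= /sqn; ring.
Qed.

Lemma spinor_mx_sqr a b c d e : spinor_mx a b c d e *m spinor_mx a b c d e =
  (sqn a b c d + e ^+ 2) *: spinor_mx a b c d e.
Proof.
have [h1 h2 h3 h4] := spinor_dot a b c d e; rewrite /spinor_mx.
move: (spinor _ _ _ _ _) (ispinor _ _ _ _ _) (_ + _) h1 h2 h3 h4 => v j N h1 h2 h3 h4.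
have sq (y z : 'rV[R]_6) : (y^T *m y) *m (z^T *m z) = y^T *m (y *m z^T) *m z.
  by rewrite !mulmxA.
rewrite mulmxDl !mulmxDr !sq h1 h2 h3 h4 !mulmx0 !mul0mx addr0 add0r.
by rewrite !mul_mx_scalar -!scalemxAl scalerDr.
Qed.

Lemma spinor_mulmx a b c d e :
  spinor a b c d e *m spinor_mx a b c d e = (sqn a b c d + e ^+ 2) *: spinor a b c d e.
Proof.
have [h1 _ h3 _] := spinor_dot a b c d e; rewrite /spinor_mx.
by rewrite mulmxDr !mulmxA h1 h3 mul0mx addr0 mul_scalar_mx.
Qed.

(** Twice [spinor_mx] of any spinor over [x]: this is linear in [x] and [radius x],
    hence continuous, although the spinor cannot be chosen continuously. *)
Definition hopf_mx x : 'M[R]_6 := \matrix_(i, j)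
  nth 0 (nth [::]
   [:: [:: radius x + x 0 2; 0; x 0 0; - x 0 1; 0; 0];
       [:: 0; radius x + x 0 2; x 0 1; x 0 0; 0; 0];
       [:: x 0 0; x 0 1; radius x - x 0 2; 0; 0; 0];
       [:: - x 0 1; x 0 0; 0; radius x - x 0 2; 0; 0]] i) j.

Lemma hopf_mxE x a b c d : hopf_lift x a b c d -> 2 *: spinor_mx a b c d 0 = hopf_mx x.
Proof.
move=> h; have rE := hopf_lift_radius h; have [x0 x1 x2] := h.
apply/matrixP => i j; rewrite !mxE !big_ord_recr !big_ord0 /= !mxE /=.
rewrite rE x0 x1 x2 /sqn.
by case: i => -[|[|[|[|[|[|//]]]]]] p; case: j => -[|[|[|[|[|[|//]]]]]] q /=; ring.
Qed.

Lemma cont_hopf_mx i j : continuous (fun x => hopf_mx x i j).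
Proof.
have cx k : continuous (fun x : 'rV[R]_3 => x 0 k) by exact: coord_continuous.
have cr := @cont_radius R.
rewrite (_ : (fun _ => _) = fun x => nth 0 (nth [::]
   [:: [:: radius x + x 0 2; 0; x 0 0; - x 0 1; 0; 0];
       [:: 0; radius x + x 0 2; x 0 1; x 0 0; 0; 0];
       [:: x 0 0; x 0 1; radius x - x 0 2; 0; 0; 0];
       [:: - x 0 1; x 0 0; 0; radius x - x 0 2; 0; 0]] i) j); last first.
  by apply/funext => x; rewrite mxE.
by case: i => -[|[|[|[|[|[|//]]]]]] p; case: j => -[|[|[|[|[|[|//]]]]]] q /=; cont.
Qed.

Lemma hopf_mx_eigen x (w : 'rV[R]_6) : x != 0 -> w *m ((2 * radius x)^-1 *: hopf_mx x) = w ->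
  w != 0 -> eigenspinor x (w 0 0) (w 0 1) (w 0 2) (w 0 3) /\
    sqn (w 0 0) (w 0 1) (w 0 2) (w 0 3) != 0.
Proof.
move=> /radius_gt0 r0 wE w0.
have {}wE i : 2 * radius x * w 0 i = \sum_j w 0 j * hopf_mx x j i.
  by rewrite -{1}wE -scalemxAr mxE mulrA divff ?mul1r ?mxE// mulf_neq0// gt_eqF.
have e0 := wE 0; have e1 := wE 1; have e2 := wE 2; have e3 := wE 3.
have e4 := wE 4; have e5 := wE 5.
rewrite !sum_ord6 !mxE /= in e0 e1 e2 e3 e4 e5.
have w4 : w 0 4 = 0.
  by apply: (mulfI (lt0r_neq0 r0)); lra.
have w5 : w 0 5 = 0.
  by apply: (mulfI (lt0r_neq0 r0)); lra.
split; first by split; lra.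
apply: contra w0 => /eqP n0; apply/eqP/rowP => i; rewrite mxE.
have [] : [/\ w 0 0 = 0, w 0 1 = 0, w 0 2 = 0 & w 0 3 = 0].
  move: n0; rewrite /sqn => /eqP; rewrite !paddr_eq0 ?addr_ge0 ?sqr_ge0// !sqrf_eq0.
  by move=> /andP[/andP[/andP[/eqP ? /eqP ?] /eqP ?] /eqP ?].
move: w4 w5; case: i => -[|[|[|[|[|[|//]]]]]] p h4 h5 h0 h1 h2 h3;
 [rewrite -[RHS]h0|rewrite -[RHS]h1|rewrite -[RHS]h2|rewrite -[RHS]h3
 |rewrite -[RHS]h4|rewrite -[RHS]h5]; congr (w _ _); exact: val_inj.
Qed.

End line_projector.

(** * Separation of three-space *)

Section enclosing_surface.
Context {R : realType}.

Let hE : hausdorff_space 'rV[R]_3 := @norm_hausdorff R 'rV[R]_3.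

(** Were the Hopf bundle trivial over [F], it would extend trivially to the enclosed
    region, hence to a line bundle on a large ball, where it would have a section;
    outside [F] this is a section of the Hopf bundle itself. The extended bundle is
    realized by lines in complex three-space. Inside, the line is spanned by the given
    lift [(a + i b, c + i d)], extended arbitrarily, completed by a third coordinate
    that vanishes on [F] and keeps the vector nonzero elsewhere. *)
Lemma eigen_section_around_surface (F : set 'rV[R]_3) : compact F -> has_lift F ->
  encloses_origin F ->
  exists2 M, 0 < M & exists2 w : 'rV[R]_3 -> 'rV[R]_6, (forall i, continuous (fun x => w x 0 i)) &
    forall x, M <= `|x| <= 2 * M -> eigenspinor x (w x 0 0) (w x 0 1) (w x 0 2) (w x 0 3) /\
      sqn (w x 0 0) (w x 0 1) (w x 0 2) (w x 0 3) != 0.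
Proof.
move=> cF [a [b [c [d [ca cb cc cd hF]]]]] [U [M [oU U0 UF0 cUF UFM]]].
have M0 : 0 < M by rewrite -(normr0 'rV[R]_3) UFM//; left.
have M20 : 0 < 2 * M by rewrite mulr_gt0.
exists M => //.
have /nbhs_normP[e /= e0 eU] : nbhs (0 : 'rV[R]_3) U by exact: open_nbhs_nbhs.
have cx k : continuous (fun x : 'rV[R]_3 => x 0 k) by exact: coord_continuous.
have cn : continuous (fun x : 'rV[R]_3 => `|x|) by exact: norm_continuous.
pose h0 (x : 'rV[R]_3) := x 0 0 - 2 * (a x * c x + b x * d x).
pose h1 (x : 'rV[R]_3) := x 0 1 - 2 * (b x * c x - a x * d x).
pose h2 (x : 'rV[R]_3) := x 0 2 - (a x ^+ 2 + b x ^+ 2 - c x ^+ 2 - d x ^+ 2).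
(* g vanishes on F; off F, where (a, b, c, d) may vanish, g does not: at nonzero x it
   sees that (a, b, c, d) does not lie over x, and near 0 it is positive anyway *)
pose g (x : 'rV[R]_3) := Num.max 0 (e - `|x|) + (h0 x ^+ 2 + h1 x ^+ 2 + h2 x ^+ 2).
have ch0 : continuous h0 by rewrite /h0; cont.
have ch1 : continuous h1 by rewrite /h1; cont.
have ch2 : continuous h2 by rewrite /h2; cont.
have cg : continuous g.
  apply: cont_add; last by cont.
  by apply: cont_max; [exact: cont_cst|cont].
have gF x : F x -> g x = 0.
  move=> Fx; have [x0 x1 x2] := hF _ Fx.
  rewrite /g /h0 /h1 /h2 -x0 -x1 -x2 !subrr expr0n !addr0 max_l//.
  rewrite subr_le0 leNgt; apply/negP => xe.
  have : (U `&` F) x by split => //; apply: eU; rewrite /= sub0r normrN.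
  by rewrite UF0.
pose N x := sqn (a x) (b x) (c x) (d x) + g x ^+ 2.
have N0 x : N x != 0.
  rewrite /N /sqn gt_eqF// lt_neqAle eq_sym !addr_ge0 ?sqr_ge0// andbT.
  rewrite !paddr_eq0 ?addr_ge0 ?sqr_ge0// !sqrf_eq0.
  apply/negP => /andP[/andP[/andP[/andP[/eqP ax /eqP bx] /eqP cx'] /eqP dx]].
  have q0 : 0 <= Num.max 0 (e - `|x|) by rewrite le_max lexx.
  rewrite /g paddr_eq0//; last by rewrite !addr_ge0 ?sqr_ge0.
  rewrite !paddr_eq0 ?addr_ge0 ?sqr_ge0// !sqrf_eq0 /h0 /h1 /h2 ax bx cx' dx.
  rewrite !mulr0 !expr0n !addr0 !subr0 !mulr0 !subr0.
  move=> /andP[/eqP m0 /andP[/andP[/eqP x0 /eqP x1] /eqP x2]].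
  have xz : x = 0 by exact: rV3_eq0.
  by move: m0; rewrite xz normr0 subr0 max_r ?ltW// => e0'; move: e0; rewrite e0' ltxx.
pose v x := spinor (a x) (b x) (c x) (d x) (g x).
pose T x := spinor_mx (a x) (b x) (c x) (d x) (g x).
have cT i j : continuous (fun x => (N x)^-1 * T x i j).
  have cN : continuous N by rewrite /N /sqn; cont.
  apply: cont_mul; first exact: (cont_inv N0 cN).
  rewrite (_ : (fun _ => _) = fun x =>
      (nth 0 [:: a x; b x; c x; d x; g x; 0] i) *
      (nth 0 [:: a x; b x; c x; d x; g x; 0] j) +
      (nth 0 [:: - b x; a x; - d x; c x; 0; g x] i) *
      (nth 0 [:: - b x; a x; - d x; c x; 0; g x] j)).
    have cs (k : 'I_6) : continuous (fun x => nth 0 [:: a x; b x; c x; d x; g x; 0] k).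
      by case: k => -[|[|[|[|[|[|//]]]]]] p /=; cont.
    have cs' (k : 'I_6) : continuous (fun x => nth 0 [:: - b x; a x; - d x; c x; 0; g x] k).
      by case: k => -[|[|[|[|[|[|//]]]]]] p /=; cont.
    by cont.
  by apply/funext => x; rewrite !mxE !big_ord_recr !big_ord0 /= !mxE !add0r.
pose W := [set x : 'rV[R]_3 | `|x| <= 2 * M].
have cW : compact W := @compact_ball_rV R 3 (2 * M).
have clW : closed W by exact: compact_closed.
pose Q := W `&` ~` U.
have clQ : closed Q by apply: closedI => //; exact: open_closedC.
have WE : (U `|` F) `|` Q = W.
  apply/seteqP; split => [x [/UFM xM|[]//]|x Wx].
    by rewrite /W /= (le_trans (ltW xM))// ler_pMl// ler1n.
  by have [Ux|nUx] := pselect (U x); [left; left|right].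
have cUFQ : compact ((U `|` F) `|` Q) by rewrite WE.
have Q0 x : Q x -> x != 0 by move=> [_ nUx]; apply/eqP => x0; apply: nUx; rewrite x0.
have cq i j : {within Q, continuous (fun x => (2 * radius x)^-1 * hopf_mx x i j)}.
  apply: cont_mul; last by apply: continuous_subspaceT; exact: cont_hopf_mx.
  apply: cont_inv_within.
    by move=> x /Q0/radius_gt0 rx; rewrite mulf_neq0 ?gt_eqF.
  apply: continuous_subspaceT; apply: cont_mul; first exact: cont_cst.
  exact: cont_radius.
have TQ i j x : (U `|` F) x -> Q x -> (N x)^-1 * T x i j = (2 * radius x)^-1 * hopf_mx x i j.
  move=> [Ux [_ /(_ Ux)]//|Fx /Q0/radius_gt0 r0].
  rewrite -(hopf_mxE (hF _ Fx)) [in RHS]mxE /T /N gF// expr0n addr0.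
  rewrite (hopf_lift_radius (hF _ Fx)) in r0 *.
  move: (sqn _ _ _ _) (spinor_mx _ _ _ _ _ i j) r0 => n m n0; field; exact: lt0r_neq0.
have entry i j := glue_extension cUF clQ cUFQ (continuous_subspaceT (cT i j)) (cq i j) (TQ i j).
have /choice[G GP] : forall ij : 'I_6 * 'I_6, exists h : 'rV[R]_3 -> R, continuous h /\
    ((forall x, (U `|` F) x -> h x = (N x)^-1 * T x ij.1 ij.2) /\
     (forall x, Q x -> h x = (2 * radius x)^-1 * hopf_mx x ij.1 ij.2)).
  by move=> [i j]; have [h ch hP] := entry i j; exists h.
(* the projector field: on U `|` F from the completed lift, on Q from the Hopf lines *)
pose P x : 'M[R]_6 := \matrix_(i, j) G (i, j) x.
have PU x : (U `|` F) x -> P x = (N x)^-1 *: T x.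
  by move=> Ux; apply/matrixP => i j; rewrite [LHS]mxE [RHS]mxE;
    have [_ [GU _]] := GP (i, j); exact: GU.
have PQ x : Q x -> P x = (2 * radius x)^-1 *: hopf_mx x.
  by move=> Qx; apply/matrixP => i j; rewrite [LHS]mxE [RHS]mxE;
    have [_ [_ GQ]] := GP (i, j); exact: GQ.
have idem (n : R) (A : 'M[R]_6) : n != 0 -> A *m A = n *: A ->
    (n^-1 *: A) *m (n^-1 *: A) = n^-1 *: A.
  by move=> n0 AA; rewrite -scalemxAl -scalemxAr AA !scalerA divfK.
have cP i j : continuous (fun x => P x i j).
  have [ch _] := GP (i, j).
  by rewrite (_ : (fun _ => _) = G (i, j))//; apply/funext => x; rewrite mxE.
have PP x : `|x| <= 2 * M -> P x *m P x = P x.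
  move=> xM; have : W x by [].
  rewrite -WE => -[Ux|Qx].
    by rewrite PU//; apply: idem => //; exact: spinor_mx_sqr.
  rewrite PQ//; have r0 := radius_gt0 (Q0 _ Qx).
  apply: idem; first by rewrite mulf_neq0// gt_eqF.
  have [a' [b' [c' [d' h]]]] := hopf_lift_exists x.
  rewrite -(hopf_mxE h) -scalemxAl -scalemxAr spinor_mx_sqr expr0n addr0.
  by rewrite (hopf_lift_radius h) !scalerA; congr (_ *: _); ring.
have v0 : v 0 != 0.
  apply/eqP => v0; have [vv _ _ _] := spinor_dot (a 0) (b 0) (c 0) (d 0) (g 0).
  move: vv; rewrite -/(v 0) v0 mul0mx => /matrixP/(_ 0 0); rewrite !mxE /= mulr1n => /esym h.
  by have := N0 0; rewrite /N h eqxx.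
have v0P : v 0 *m P 0 = v 0.
  rewrite PU; last by left.
  by rewrite -scalemxAr /v /T spinor_mulmx scalerA mulVf ?scale1r.
have [w cw wP] := projector_section cW M20 cP PP v0 v0P.
exists w => // x /andP[Mx xM].
have Qx : Q x by split => // Ux; have := UFM _ (or_introl Ux); rewrite ltNge Mx.
have [wx w0] := wP x xM.
by apply: hopf_mx_eigen => //; [exact: Q0|rewrite -PQ].
Qed.

Definition above (z : 'rV[R]_2) (t : R) : 'rV[R]_3 := \row_i nth 0 [:: z 0 0; z 0 1; t] i.

Lemma aboveE z t : (above z t 0 0 = z 0 0) * (above z t 0 1 = z 0 1) * (above z t 0 2 = t).
Proof. by rewrite !mxE. Qed.

Lemma norm_above z t : `|above z t| = Num.max `|z| `|t|.
Proof.
apply/eqP; rewrite eq_le; apply/andP; split.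
  apply: norm_rV_le => [|i]; first by rewrite le_max normr_ge0.
  have z0 := coord_norm_rV z 0; have z1 := coord_norm_rV z 1.
  by rewrite le_max mxE; case: i => -[|[|[|//]]] p /=; rewrite ?z0 ?z1 ?lexx ?orbT.
rewrite ge_max -{2}(aboveE z t).2 coord_norm_rV andbT.
apply: norm_rV_le => // i; case: i => -[|[|//]] p.
  by rewrite (_ : Ordinal p = 0) -?(aboveE z t).1.1 ?coord_norm_rV//; exact: val_inj.
by rewrite (_ : Ordinal p = 1) -?(aboveE z t).1.2 ?coord_norm_rV//; exact: val_inj.
Qed.

(** The Hopf bundle has degree one on spheres around the origin. Here a section is
    restricted to a bipyramid, made of the graphs of [2 M - |z|] and its opposite over
    a square. On the upper half its first complex component vanishes nowhere, and on
    the lower half its second one, so that both have angles there; on the common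
    boundary their quotient points in the direction of [z], which has no angle. *)
Lemma enclosing_surface_no_lift (F : set 'rV[R]_3) :
  compact F -> encloses_origin F -> ~ has_lift F.
Proof.
move=> cF eF lF.
have [M M0 [w cw wP]] := eigen_section_around_surface cF lF eF.
have M20 : 0 < 2 * M by rewrite mulr_gt0.
pose W := [set z : 'rV[R]_2 | `|z| <= 2 * M].
have cW : compact W := @compact_ball_rV R 2 (2 * M).
pose up z := above z (2 * M - `|z|); pose down z := above z (- (2 * M - `|z|)).
have cz k : continuous (fun z : 'rV[R]_2 => z 0 k) by exact: coord_continuous.
have cn : continuous (fun z : 'rV[R]_2 => `|z|) by exact: norm_continuous.
have cabove (t : 'rV[R]_2 -> R) : continuous t -> continuous (fun z => above z (t z)).
  move=> ct; apply: cont_rV => i.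
  rewrite (_ : (fun _ => _) = fun z : 'rV[R]_2 => nth 0 [:: z 0 0; z 0 1; t z] i).
    by case: i => -[|[|[|//]]] p /=.
  by apply/funext => z; rewrite mxE.
have cup : continuous up by apply: cabove; cont.
have cdown : continuous down by apply: cabove; cont.
(* the bipyramid avoids the ball of radius M, where the section is not under control *)
have range z t : W z -> `|t| = 2 * M - `|z| -> M <= `|above z t| <= 2 * M.
  rewrite /W /= => zM tE; rewrite norm_above tE le_max ge_max zM gerBl normr_ge0 andbT/=.
  by have [//|zM'] := leP M `|z|; lra.
have upP z (Wz : W z) : eigenspinor (up z)
      (w (up z) 0 0) (w (up z) 0 1) (w (up z) 0 2) (w (up z) 0 3) /\
      sqn (w (up z) 0 0) (w (up z) 0 1) (w (up z) 0 2) (w (up z) 0 3) != 0.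
  by apply/wP/range => //; rewrite ger0_norm// subr_ge0.
have downP z (Wz : W z) : eigenspinor (down z)
      (w (down z) 0 0) (w (down z) 0 1) (w (down z) 0 2) (w (down z) 0 3) /\
      sqn (w (down z) 0 0) (w (down z) 0 1) (w (down z) 0 2) (w (down z) 0 3) != 0.
  by apply/wP/range => //; rewrite normrN ger0_norm// subr_ge0.
have nz z t : W z -> `|t| = 2 * M - `|z| -> 0 < radius (above z t).
  move=> Wz tE; apply: radius_gt0; rewrite -normr_gt0.
  by have /andP[+ _] := range z t Wz tE; exact: lt_le_trans.
have a0 z : W z -> w (up z) 0 0 ^+ 2 + w (up z) 0 1 ^+ 2 != 0.
  move=> Wz; have [[_ _ ec ed] n0] := upP z Wz.
  apply: contra n0; rewrite paddr_eq0 ?sqr_ge0// !sqrf_eq0 => /andP[/eqP h0 /eqP h1].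
  have tz : 0 <= 2 * M - `|z| by rewrite subr_ge0.
  have rz : 0 < radius (up z) by apply: nz => //; rewrite ger0_norm.
  move: ec ed; rewrite h0 h1 /up !aboveE -/(up z) => ec ed.
  have rt : radius (up z) + (2 * M - `|z|) != 0 by rewrite gt_eqF//; lra.
  have -> : w (up z) 0 2 = 0 by apply: (mulfI rt); lra.
  have -> : w (up z) 0 3 = 0 by apply: (mulfI rt); lra.
  by rewrite /sqn !expr0n !addr0.
have b0 z : W z -> w (down z) 0 2 ^+ 2 + w (down z) 0 3 ^+ 2 != 0.
  move=> Wz; have [[ea eb _ _] n0] := downP z Wz.
  apply: contra n0; rewrite paddr_eq0 ?sqr_ge0// !sqrf_eq0 => /andP[/eqP h2 /eqP h3].
  have tz : 0 <= 2 * M - `|z| by rewrite subr_ge0.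
  have rz : 0 < radius (down z) by apply: nz => //; rewrite normrN ger0_norm.
  move: ea eb; rewrite h2 h3 /down !aboveE -/(down z) => ea eb.
  have rt : radius (down z) + (2 * M - `|z|) != 0 by rewrite gt_eqF//; lra.
  have -> : w (down z) 0 0 = 0 by apply: (mulfI rt); lra.
  have -> : w (down z) 0 1 = 0 by apply: (mulfI rt); lra.
  by rewrite /sqn !expr0n !addr0.
have [s cs sE] := has_angle_ball cW M20 (cont_comp (cw 0) cup) (cont_comp (cw 1) cup) a0.
have [t ct tE] := has_angle_ball cW M20 (cont_comp (cw 2) cdown) (cont_comp (cw 3) cdown) b0.
apply: (no_angle_around_origin M20); exists (fun z => s z - t z); first by cont.
move=> z zM; have Wz : W z by rewrite /W /= zM.
have du : up z = down z by rewrite /up /down zM subrr oppr0.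
have rz : 0 < radius (up z) by apply: nz; rewrite // zM subrr normr0.
have [[ea eb _ _] _] := upP z Wz; have bz := b0 z Wz.
have := angle_mul (sE z Wz) (angle_conj (tE z Wz)).
rewrite -du in bz *; move: ea eb bz; rewrite {2 4}/up !aboveE -/(up z) zM subrr !mul0r !add0r.
move: (w (up z) 0 0) (w (up z) 0 1) (w (up z) 0 2) (w (up z) 0 3) => a b c d ea eb cd0.
have {}cd0 : 0 < c ^+ 2 + d ^+ 2 by rewrite lt_neqAle eq_sym cd0 addr_ge0 ?sqr_ge0.
have k0 : 0 < radius (up z) / (c ^+ 2 + d ^+ 2) by rewrite divr_gt0.
move=> /(angle_scale k0).
have -> : radius (up z) / (c ^+ 2 + d ^+ 2) * (a * c - b * - d) = z 0 0.
  rewrite mulrAC -[RHS](mulfK (lt0r_neq0 cd0)); congr (_ / _).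
  transitivity ((radius (up z) * a) * c + (radius (up z) * b) * d); first ring.
  by rewrite ea eb; ring.
have -> : radius (up z) / (c ^+ 2 + d ^+ 2) * (a * - d + b * c) = z 0 1.
  rewrite mulrAC -[RHS](mulfK (lt0r_neq0 cd0)); congr (_ / _).
  transitivity ((radius (up z) * b) * c - (radius (up z) * a) * d); first ring.
  by rewrite ea eb; ring.
by [].
Qed.

End enclosing_surface.

(** * Round spheres *)

Section dot.
Context {R : realType} {n : nat}.
Implicit Types x y z : 'rV[R]_n.

Definition dot x y : R := (x *m y^T) 0 0.

Lemma dotE x y : dot x y = \sum_i x 0 i * y 0 i.
Proof. by rewrite /dot mxE; apply: eq_bigr => i _; rewrite mxE. Qed.
Lemma dotC x y : dot x y = dot y x.
Proof. by rewrite !dotE; apply: eq_bigr => i _; rewrite mulrC. Qed.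
Lemma dotDl x y z : dot (x + y) z = dot x z + dot y z.
Proof. by rewrite /dot mulmxDl mxE. Qed.
Lemma dotZl a x z : dot (a *: x) z = a * dot x z.
Proof. by rewrite /dot -scalemxAl mxE. Qed.
Lemma dotNl x z : dot (- x) z = - dot x z.
Proof. by rewrite /dot mulNmx mxE. Qed.
Lemma dotDr x y z : dot z (x + y) = dot z x + dot z y.
Proof. by rewrite dotC dotDl !(dotC z). Qed.
Lemma dotZr a x z : dot z (a *: x) = a * dot z x.
Proof. by rewrite dotC dotZl (dotC z). Qed.
Lemma dotNr x z : dot z (- x) = - dot z x.
Proof. by rewrite dotC dotNl (dotC z). Qed.
Definition dot_linear := (dotDl, dotDr, dotNl, dotNr, dotZl, dotZr).

Lemma dot_ge0 x : 0 <= dot x x.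
Proof. by rewrite dotE sumr_ge0// => i _; rewrite -expr2 sqr_ge0. Qed.

Lemma dot_eq0 x : (dot x x == 0) = (x == 0).
Proof.
apply/idP/eqP => [|->]; last by rewrite /dot mul0mx mxE.
rewrite dotE psumr_eq0 => [|i _]; last by rewrite -expr2 sqr_ge0.
move=> /allP x0; apply/rowP => i; rewrite mxE; apply/eqP.
by rewrite -sqrf_eq0 expr2; exact: (x0 i (mem_index_enum i)).
Qed.

Lemma dot_gt0 x : x != 0 -> 0 < dot x x.
Proof. by move=> x0; rewrite lt_neqAle eq_sym dot_eq0 x0 dot_ge0. Qed.

Lemma cont_dot x : continuous (dot x).
Proof.
rewrite (_ : dot x = fun y => \sum_i x 0 i * y 0 i).
  apply: cont_sum => i; apply: cont_mul; first exact: cont_cst.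
  exact: coord_continuous.
by apply/funext => y; rewrite dotE.
Qed.

Lemma unit_line x y z a : dot x x = 1 -> dot y y = 1 -> dot z z = 1 -> x != z ->
  y - z = a *: (x - z) -> y = x \/ y = z.
Proof.
move=> x1 y1 z1; rewrite -subr_eq0 => xz yE.
have yE' : y = z + a *: (x - z) by rewrite -yE addrC subrK.
have p0 := dot_gt0 xz.
have xE : x = z + (x - z) by rewrite addrC subrK.
move: (x - z) xz yE yE' p0 xE => p xz yE yE' p0 xE.
move: y1 x1; rewrite xE yE' !dot_linear z1 (dotC p z) => y1 x1.
have /eqP : a * (a - 1) * dot p p = 0.
  have e1 : 2 * dot z p = - dot p p by lra.
  have : a * (2 * dot z p) + a ^+ 2 * dot p p = 0 by lra.
  by rewrite e1 => h; lra.
rewrite !mulf_eq0 (gt_eqF p0) orbF subr_eq0 => /orP[/eqP ->|/eqP ->].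
  by right; rewrite scale0r addr0.
by left; rewrite scale1r.
Qed.

(** Points of the unit sphere are never aligned, so a hyperplane through one of them
    can separate two others. With [p = x - z] and [q = y - z], the normal [v] solves
    [dot v p = e] and [dot v q = - e], where [e] is the Gram determinant. *)
Lemma separating_normal x y z : dot x x = 1 -> dot y y = 1 -> dot z z = 1 ->
  x != y -> x != z -> y != z ->
  exists v, 0 < dot v (x - z) /\ dot v (y - z) < 0.
Proof.
move=> x1 y1 z1 xy xz yz.
set p := x - z; set q := y - z.
have p0 : 0 < dot p p by rewrite dot_gt0// subr_eq0.
have q0 : 0 < dot q q by rewrite dot_gt0// subr_eq0.
have nline t : q <> t *: p.
  move=> qE; have [yx|yz'] := unit_line x1 y1 z1 xz qE; first by rewrite yx eqxx in xy.
  by rewrite yz' eqxx in yz.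
clearbody p q.
pose s := dot q q + dot p q; pose t := dot p p + dot p q.
pose e := dot p p * dot q q - dot p q ^+ 2.
have e0 : 0 < e.
  have w0 : dot p p *: q - dot p q *: p != 0.
    apply/eqP => /eqP; rewrite subr_eq0 => /eqP w0.
    apply: (nline (dot p q / dot p p)).
    by rewrite mulrC -scalerA -w0 scalerA mulVf ?scale1r// gt_eqF.
  have := dot_gt0 w0; rewrite !dot_linear (dotC q p) => w1.
  rewrite -(pmulr_rgt0 _ p0) /e; lra.
exists (s *: p - t *: q); rewrite !dot_linear (dotC q p) /s /t; split.
  by move: e0; rewrite /e; lra.
by move: e0; rewrite /e; lra.
Qed.

(** A round subsphere: the unit vectors of the affine subspace through [a] with
    normals the rows of [M]. *)
Definition section k (M : 'M[R]_(k, n)) (a : 'rV[R]_n) : set 'rV[R]_n :=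
  [set y | dot y y = 1 /\ M *m (y - a)^T = 0].

(** A section of rank at least [n - 1] is a sphere of dimension at most zero. *)
Lemma section_line k (M : 'M[R]_(k, n)) a x y z : (n <= (\rank M).+1)%N ->
  section M a x -> section M a y -> section M a z -> x != z -> y = x \/ y = z.
Proof.
move=> rM [x1 Mx] [y1 My] [z1 Mz] xz.
have ker w : section M a w -> (w - z <= kermx M^T)%MS.
  move=> [_ Mw]; apply/sub_kermxP/trmx_inj.
  rewrite trmx_mul trmxK trmx0 (_ : w - z = (w - a) - (z - a)).
    by rewrite linearB /= mulmxBr Mw Mz subrr.
  by rewrite opprB addrA subrK.
have ky := ker y (conj y1 My); have kx := ker x (conj x1 Mx).
have rx : \rank (x - z) = 1%N by rewrite rank_rV subr_eq0 xz.
have rk : (\rank (kermx M^T) <= 1)%N.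
  by rewrite mxrank_ker mxrank_tr leq_subLR addn1.
have kxx : (kermx M^T <= x - z)%MS.
  by rewrite -(geq_leqif (mxrank_leqif_sup kx)) rx.
have /sub_rVP[t tE] := submx_trans ky kxx.
exact: unit_line x1 y1 z1 xz tE.
Qed.

Lemma section_base k (M : 'M[R]_(k, n)) a z y : section M a z ->
  section M a y <-> section M z y.
Proof.
move=> [z1 Mz]; rewrite /section /= (_ : y - a = (y - z) + (z - a)); last first.
  by rewrite addrA subrK.
by rewrite linearD /= mulmxDr Mz addr0.
Qed.

Lemma rank_separating k (M : 'M[R]_(k, n)) a v x y z :
  section M a x -> section M a y -> 0 < dot v (x - z) -> dot v (y - z) < 0 ->
  (\rank M < \rank (col_mx M v))%N.
Proof.
move=> [_ Mx] [_ My] vx vy.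
have sub : (M <= col_mx M v)%MS by rewrite -addsmxE addsmxSl.
rewrite ltnNge (geq_leqif (mxrank_leqif_sup sub)) -addsmxE addsmx_sub submx_refl /=.
apply/negP => /submxP[D vE].
have : dot v (x - y) = 0.
  rewrite /dot vE -mulmxA (_ : x - y = (x - a) - (y - a)).
    by rewrite linearB /= mulmxBr Mx My subrr mulmx0 mxE.
  by rewrite opprB addrA subrK.
rewrite (_ : x - y = (x - z) - (y - z)); first by rewrite !dot_linear in vx vy *; lra.
by rewrite opprB addrA subrK.
Qed.

End dot.

(** * Round spheres are filled by the images of cohomologically nontrivial sets *)

Section filling.
Context {R : realType} {X : pseudoMetricType R} {n : nat}.
Variable f : X -> 'rV[R]_n.
Hypothesis hX : hausdorff_space X.
Hypothesis f_inj : injective f.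
Hypothesis f_unit : forall x, dot (f x) (f x) = 1.
Hypothesis f_connected : forall C, connected C -> connected (f @` C).

(** [L F T] says that [T] is one of the vanishing conditions, for classes of a certain
    degree [j], that make sense on the compact subsets of [F]. The filling property
    for [d = n - 1 - j]: a compact set that carries a nontrivial class of degree [j],
    and that [f] maps into a round sphere of dimension at most [j], is mapped onto it. *)
Definition filling (L : set X -> set (set X) -> Prop) (d : nat) :=
  forall F T, L F T -> compact F -> ~ T F ->
  forall k (M : 'M[R]_(k, n)) a, (d <= \rank M)%N ->
  f @` F `<=` section M a -> section M a `<=` f @` F.

Lemma filling_base (L : set X -> set (set X) -> Prop) d : (n <= d.+1)%N ->
  (forall F T, L F T -> (forall x y, F x -> F y -> x = y) -> T F) -> filling L d.
Proof.
move=> nd LT F T LFT _ nTF k M a dM fF z Mz; apply: contrapT => nz.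
apply: nTF; apply: LT => // x y Fx Fy; apply: f_inj.
have fs u : F u -> section M a (f u) by move=> Fu; apply: fF; exists u.
have fz u : F u -> f u != z by move=> Fu; apply/eqP => uz; apply: nz; exists u.
have [|//|E] := section_line _ (fs x Fx) (fs y Fy) Mz (fz x Fx).
  exact: leq_trans nd _.
by have := fz y Fy; rewrite E eqxx.
Qed.

(** The induction on the degree. If [f @` F] misses the point [z] of the round sphere,
    take a minimal carrier [K] of the class and cut the sphere by a hyperplane
    through [z] that separates two points of [f @` K]. As [f] is Darboux, the preimage
    of the hyperplane separates [K] into two smaller closed sets, on which the class
    vanishes; by Mayer-Vietoris their intersection carries a nontrivial class one
    degree lower, so by induction its image contains the smaller round sphere, and
    [z] with it. *)
Lemma filling_step (L L' : set X -> set (set X) -> Prop) d : filling L d.+1 ->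
  (forall F T, L' F T -> [/\ open_on_compacts F T,
    (forall K, K `<=` F -> (forall x y, K x -> K y -> x = y) -> T K) &
    (forall A B, compact A -> compact B -> A `|` B `<=` F -> T A -> T B -> ~ T (A `|` B) ->
      exists2 T', L (A `&` B) T' & ~ T' (A `&` B))]) ->
  filling L' d.
Proof.
move=> fL LL' F T LFT cF nTF k M a dM fF z Mz; apply: contrapT => nz.
have [oT T1 TU] := LL' _ _ LFT.
have [K [KF cK nTK Kmin]] := minimal_compact hX oT cF nTF.
have [[x0 [x1 [Kx0 Kx1 x01]]]|K1] := pselect (exists x y, [/\ K x, K y & x <> y]); last first.
  by apply: nTK; apply: T1 => // x y Kx Ky; apply: contrapT => xy; apply: K1; exists x, y.
have fs u : K u -> section M a (f u) by move=> /KF Fu; apply: fF; exists u.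
have fz u : K u -> f u != z by move=> /KF Fu; apply/eqP => uz; apply: nz; exists u.
have [z1 Mz0] := Mz.
have [|v [v0 v1]] := separating_normal (f_unit x0) (f_unit x1) z1 _ (fz _ Kx0) (fz _ Kx1).
  by apply/eqP => /f_inj.
pose C := [set x | dot v (f x - z) = 0].
have nC : ~ connected (K `\` C).
  move=> /f_connected fKC.
  have cv : continuous (fun y : 'rV[R]_n => dot v (y - z)).
    rewrite (_ : (fun _ => _) = fun y : 'rV[R]_n => dot v y + dot v (- z)).
      by apply: cont_add; [exact: cont_dot|exact: cont_cst].
    by apply/funext => y; rewrite dotDr.
  have := connected_continuous_connected fKC (continuous_subspaceT cv).
  move=> /connected_intervalP itv.
  have KC u : K u -> dot v (f u - z) != 0 ->
      ((fun y : 'rV[R]_n => dot v (y - z)) @` (f @` (K `\` C))) (dot v (f u - z)).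
    by move=> Ku /eqP vu; exists (f u) => //; exists u.
  have := itv _ _ (KC _ Kx1 (ltr0_neq0 v1)) (KC _ Kx0 (lt0r_neq0 v0)) 0.
  by rewrite (ltW v0) (ltW v1) => /(_ isT)[_ [u [_ nCu] <-]].
have [A [B [cA cB ABK ABC [nA nB]]]] := disconnected_closed_cover (compact_closed hX cK) nC.
have AK : A `<=` K by rewrite -ABK; exact: subsetUl.
have BK : B `<=` K by rewrite -ABK; exact: subsetUr.
have cptA : compact A by exact: subclosed_compact cA cK AK.
have cptB : compact B by exact: subclosed_compact cB cK BK.
have [T' LT' nT'] : exists2 T', L (A `&` B) T' & ~ T' (A `&` B).
  apply: TU => //; rewrite ?ABK//; exact: Kmin.
have sM' : section (col_mx M v) z z by split; rewrite // subrr trmx0 mulmx0.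
have rM' : (d < \rank (col_mx M v))%N.
  exact: leq_ltn_trans dM (rank_separating (fs _ Kx0) (fs _ Kx1) v0 v1).
have cAB : compact (A `&` B) by exact: compact_closedI.
have fAB : f @` (A `&` B) `<=` section (col_mx M v) z.
  move=> _ [u [Au Bu] <-].
  have [u1 Mu] := (section_base (f u) Mz).1 (fs _ (AK _ Au)).
  split => //; rewrite mul_col_mx Mu (_ : v *m _ = 0) ?col_mx0//.
  by apply/matrixP => i j; rewrite !ord1 [RHS]mxE; exact: (ABC u (conj Au Bu)).
have [u [Au _] uz] := fL _ _ LT' cAB nT' _ _ _ rM' fAB z sM'.
by have := fz u (AK _ Au); rewrite uz eqxx.
Qed.

End filling.

(** Degree zero: the vanishing condition for reduced classes is to be connected, but
    for sets mapped injectively into a sphere of dimension zero, that is into two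
    points, having at most one point amounts to the same and is easier to use. *)
Definition level0 (X : topologicalType) (F : set X) (T : set (set X)) :=
  T = [set K | forall x y, K x -> K y -> x = y].

Definition level1 (R : realType) (X : topologicalType) (F : set X) (T : set (set X)) :=
  exists u v : X -> R, [/\ continuous u, continuous v,
    forall x, F x -> u x ^+ 2 + v x ^+ 2 != 0 & T = has_angle u v].

Definition level2 (R : realType) (F : set 'rV[R]_3) (T : set (set 'rV[R]_3)) :=
  ~ F 0 /\ T = @has_lift R.

Section levels.
Context {R : realType} {X : pseudoMetricType R} {n : nat}.
Variable f : X -> 'rV[R]_n.
Hypothesis hX : hausdorff_space X.
Hypothesis f_inj : injective f.
Hypothesis f_unit : forall x, dot (f x) (f x) = 1.
Hypothesis f_connected : forall C, connected C -> connected (f @` C).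

Lemma filling_level0 d : (n <= d.+1)%N -> filling f (@level0 X) d.
Proof. by move=> nd; apply: filling_base => // F T ->. Qed.

Lemma filling_level1 d : (n <= d.+2)%N -> filling f (@level1 R X) d.
Proof.
move=> nd; apply: (filling_step hX f_inj f_unit f_connected (filling_level0 nd)).
move=> F T [u [v [cu cv uv ->]]]; split; first exact: has_angle_open.
  by move=> K KF K1; apply: has_angle_subsingleton => // x /KF; exact: uv.
move=> A B cA cB ABF TA TB nT; exists [set K | forall x y, K x -> K y -> x = y] => //.
move=> AB1; apply: nT; apply: has_angle_glue => //; try exact: compact_closed.
  exact: compactU.
by move=> x y Ax Bx Ay By; exact: (AB1 x y (conj Ax Bx) (conj Ay By)).
Qed.

End levels.

Lemma filling_level2 (R : realType) n (f : 'rV[R]_3 -> 'rV[R]_n) d :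
  injective f -> (forall x, dot (f x) (f x) = 1) ->
  (forall C, connected C -> connected (f @` C)) -> (n <= d.+3)%N ->
  filling f (@level2 R) d.
Proof.
move=> f_inj f1 fc nd; have hE : hausdorff_space 'rV[R]_3 by exact: norm_hausdorff.
apply: (filling_step hE f_inj f1 fc (filling_level1 hE f_inj f1 fc nd)).
move=> F T [F0 ->]; split; first exact: has_lift_open.
  by move=> K KF; exact: has_lift_subsingleton.
move=> A B cA cB ABF TA TB nT.
have [||||u [v [cu cv uv nuv]]] := has_lift_glue _ _ _ _ TA TB nT.
- exact: compact_closed.
- exact: compact_closed.
- exact: compactU.
- by move=> [A0 _]; apply: F0; apply: ABF; left.
by exists (has_angle u v) => //; exists u, v.
Qed.

(** All that the proof needs to know about the dimension [n]. *)
Definition enclosing_filling (R : realType) (n : nat) :=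
  forall f : 'rV[R]_n -> 'rV[R]_n.+1, injective f ->
  (forall x, dot (f x) (f x) = 1) ->
  (forall C, connected C -> connected (f @` C)) ->
  forall F, compact F -> encloses_origin F ->
  forall k (M : 'M[R]_(k, n.+1)) a, (0 < \rank M)%N ->
  f @` F `<=` section M a -> section M a `<=` f @` F.

Lemma encloses_origin_neq0 (R : realType) n (F : set 'rV[R]_n) : encloses_origin F -> ~ F 0.
Proof.
by move=> [U [M [_ U0 UF _ _]]] F0; rewrite -[False]/(set0 (0 : 'rV[R]_n)) -UF.
Qed.

Lemma enclosing_filling2 (R : realType) : enclosing_filling R 2.
Proof.
move=> f fi f1 fc F cF eF k M a rM.
have hE : hausdorff_space 'rV[R]_2 by exact: norm_hausdorff.
have L : level1 R F (has_angle (fun x : 'rV[R]_2 => x 0 0) (fun x => x 0 1)).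
  exists (fun x : 'rV[R]_2 => x 0 0), (fun x : 'rV[R]_2 => x 0 1).
  split => //; try exact: coord_continuous.
  move=> x Fx; rewrite gt_eqF// rV2_norm_gt0//; apply/eqP => x0.
  by apply: (encloses_origin_neq0 eF); rewrite -x0.
exact: (filling_level1 (d := 1) hE fi f1 fc (leqnn 3) L cF (enclosing_curve_no_angle cF eF) rM).
Qed.

Lemma enclosing_filling3 (R : realType) : enclosing_filling R 3.
Proof.
move=> f fi f1 fc F cF eF k M a rM.
have L : level2 F (@has_lift R) by split => //; exact: encloses_origin_neq0.
exact: (filling_level2 (d := 1) fi f1 fc (leqnn 4) L cF (enclosing_surface_no_lift cF eF) rM).
Qed.

(** * Darboux functions with closed fibres, and stereographic projection *)

Section locally_connected.
Context {R : realType} {X : topologicalType}.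

Definition locally_connected :=
  forall (x : X) (O : set X), nbhs x O -> exists N, [/\ connected N, N `<=` O & nbhs x N].

(** A small connected neighbourhood of [x] avoids the fibres over [g x - e] and
    [g x + e], so its image, an interval, stays between these two values. *)
Lemma closed_fibers_continuous (g : X -> R) : locally_connected ->
  (forall C, connected C -> connected (g @` C)) ->
  (forall c, closed [set x | g x = c]) -> continuous g.
Proof.
move=> lc gc gcl x; apply/cvgrPdist_lt => e e0.
have [|N [cN NO xN]] := lc x (~` [set y | g y = g x - e] `&` ~` [set y | g y = g x + e]).
  by apply: filterI; apply: open_nbhs_nbhs; split; rewrite /=; try exact: closed_openC; lra.
have /connected_intervalP itv := gc N cN.
have gx : (g @` N) (g x) by exists x => //; exact: nbhs_singleton.
apply: filterS xN => y Ny.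
have gy : (g @` N) (g y) by exists y.
have off z : N z -> g z <> g x - e /\ g z <> g x + e by move=> /NO[].
rewrite ltr_norml; apply/andP; split; rewrite ltNge; apply/negP => h.
  have [|z Nz zE] := itv _ _ gx gy (g x + e); first by apply/andP; split; lra.
  by have [_] := off z Nz; apply.
have [|z Nz zE] := itv _ _ gy gx (g x - e); first by apply/andP; split; lra.
by have [+ _] := off z Nz; apply.
Qed.
End locally_connected.

Section stereographic.
Context {R : realType} {n : nat}.

Let V := 'rV[R]_n.+1.

(** Linear coordinates on the hyperplane orthogonal to [q]; [C] maps a vector to its
    coordinates in the basis formed by the rows of [B]. *)
Lemma orthogonal_basis (q : V) : q != 0 ->
  exists B : 'M[R]_(n, n.+1), exists C : 'M[R]_(n.+1, n), [/\ B *m C = 1%:M,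
    forall y : 'rV[R]_n, dot (y *m B) q = 0 &
    forall v : V, dot v q = 0 -> v *m C *m B = v].
Proof.
move=> q0; pose K := kermx q^T.
have rK : \rank K = n by rewrite mxrank_ker mxrank_tr rank_rV q0 subn1.
have [B [fB BK]] : exists B : 'M[R]_(n, n.+1), row_free B /\ (B == K)%MS.
  have gen r : r = \rank K -> exists B : 'M[R]_(r, n.+1), row_free B /\ (B == K)%MS.
    by move=> ->; exists (row_base K); rewrite row_base_free; split => //; exact/eqmxP/eq_row_base.
  exact: gen (esym rK).
exists B, (pinvmx B); split.
- by rewrite mulmxVp.
- move=> y; have : (y *m B <= K)%MS by rewrite -(eqmxP BK) submxMl.
  by move=> /sub_kermxP; rewrite /dot => ->; rewrite mxE.
- move=> v vq; apply: mulmxKpV; rewrite (eqmxP BK); apply/sub_kermxP.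
  by apply/matrixP => i j; rewrite !ord1 [RHS]mxE.
Qed.

(** Stereographic projection from the pole [q] onto the hyperplane orthogonal to [q],
    written with inner products only, so that no coordinate system is singled out. *)
Definition inverse_stereo (q v : V) : V :=
  (dot v v + 1)^-1 *: (2 *: v + (dot v v - 1) *: q).
Definition stereo (q x : V) : V := (1 - dot x q)^-1 *: (x - dot x q *: q).

Lemma dotvv1_gt0 (v : V) : 0 < dot v v + 1.
Proof. by rewrite ltr_wpDl// dot_ge0. Qed.

Lemma inverse_stereo_dot (q v : V) : dot q q = 1 -> dot v q = 0 ->
  1 - dot (inverse_stereo q v) q = 2 / (dot v v + 1).
Proof.
move=> q1 vq; have s0 := lt0r_neq0 (dotvv1_gt0 v).
by rewrite !dot_linear q1 vq; field.
Qed.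

Lemma inverse_stereo_unit (q v : V) : dot q q = 1 -> dot v q = 0 ->
  dot (inverse_stereo q v) (inverse_stereo q v) = 1.
Proof.
move=> q1 vq; have s0 := lt0r_neq0 (dotvv1_gt0 v).
by rewrite /inverse_stereo !dot_linear q1 (dotC q v) vq; field.
Qed.

Lemma inverse_stereoK (q v : V) : dot q q = 1 -> dot v q = 0 ->
  stereo q (inverse_stereo q v) = v.
Proof.
move=> q1 vq; have s0 := lt0r_neq0 (dotvv1_gt0 v).
rewrite /stereo inverse_stereo_dot// invf_div.
have -> : dot (inverse_stereo q v) q = (dot v v - 1) / (dot v v + 1).
  by rewrite !dot_linear q1 vq; field.
apply/rowP => i; rewrite !mxE; field.
by [].
Qed.

Lemma stereo_orthogonal (q x : V) : dot q q = 1 -> dot (stereo q x) q = 0.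
Proof. by move=> q1; rewrite !dot_linear q1 mulr1 subrr mulr0. Qed.

Lemma stereoK (q x : V) : dot q q = 1 -> dot x x = 1 -> dot x q != 1 ->
  inverse_stereo q (stereo q x) = x.
Proof.
move=> q1 x1; rewrite eq_sym -subr_eq0 => xq.
have sE : dot (stereo q x) (stereo q x) = (1 + dot x q) / (1 - dot x q).
  by rewrite /stereo !dot_linear q1 x1 (dotC q x); field.
rewrite /inverse_stereo sE; apply/rowP => i; rewrite !mxE; field.
by rewrite xq (_ : _ + _ + _ = 2) ?pnatr_eq0//; ring.
Qed.

Lemma unit_dot_neq1 (x q : V) : dot x x = 1 -> dot q q = 1 -> x != q -> dot x q != 1.
Proof.
move=> x1 q1; apply: contra => /eqP xq; rewrite -subr_eq0 -dot_eq0.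
by rewrite !dot_linear x1 q1 (dotC q x) xq; apply/eqP; lra.
Qed.

Lemma cont_dotr (v : V) : continuous (fun x => dot x v).
Proof.
rewrite (_ : (fun _ => _) = dot v); first exact: cont_dot.
by apply/funext => x; rewrite dotC.
Qed.

Lemma cont_dot_self : continuous (fun x : V => dot x x).
Proof.
rewrite (_ : (fun _ => _) = fun x : V => \sum_i x 0 i * x 0 i).
  by apply: cont_sum => i; apply: cont_mul; exact: coord_continuous.
by apply/funext => y; rewrite dotE.
Qed.

End stereographic.

(** * Topology of the sphere *)

Section sphere_topology.
Context {R : realType} {n : nat}.

Let X : pseudoMetricType R := sphere R n.

Lemma sphereE (x : 'rV[R]_n.+1) : sphere R n x <-> dot x x = 1.
Proof.
rewrite /sphere /= /euclidean_norm dotE.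
under [in X in _ <-> X]eq_bigr do rewrite -expr2.
split => [h|->]; last by rewrite sqrtr1.
have := congr1 (fun z => z ^+ 2) h; rewrite expr1n sqr_sqrtr//.
by rewrite sumr_ge0// => i _; rewrite sqr_ge0.
Qed.

Definition point_of (x : 'rV[R]_n.+1) (hx : dot x x = 1) : X :=
  exist (fun y => y \in sphere R n) x (mem_set ((sphereE x).2 hx)).

Lemma sphere_dot (x : X) : dot (\val x) (\val x) = 1.
Proof. by apply/sphereE/set_mem; exact: valP. Qed.

Lemma cont_val : continuous (\val : X -> 'rV[R]_n.+1).
Proof. exact: initial_continuous. Qed.

Lemma cont_sphere (T : topologicalType) (g : T -> X) :
  continuous (fun t => \val (g t)) -> continuous g.
Proof. by move=> cg; apply: continuous_comp_initial. Qed.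

Lemma sphere_hausdorff : hausdorff_space X.
Proof.
move=> x y xy; apply: val_inj; apply: (@norm_hausdorff R 'rV[R]_n.+1) => A B xA yB.
have [z [Az Bz]] := xy _ _ (cont_val xA) (cont_val yB).
by exists (\val z).
Qed.

Lemma sphere_compact : compact [set: X].
Proof.
have cS : compact (sphere R n).
  apply: (@subclosed_compact _ _ [set x | `|x| <= 1]); last 2 first.
  - exact: compact_ball_rV.
  - move=> x /sphereE x1; apply: norm_rV_le => // i.
    rewrite -[leRHS]sqrtr1 -x1 -sqrtr_sqr ler_sqrt; last by rewrite x1.
    rewrite dotE (bigD1 i)//= -expr2 lerDl sumr_ge0// => j _.
    by rewrite -expr2 sqr_ge0.
  rewrite (_ : sphere R n = [set x | dot x x - 1 = 0]).
    apply: closed_eq0; apply: cont_add; last exact: cont_cst.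
    exact: cont_dot_self.
  by apply/seteqP; split => x /=; rewrite sphereE => h; lra.
move=> F FF FT.
have [|x [Sx Fx]] := cS (\val @ F) _.
  suff : F (\val @^-1` (sphere R n)) by [].
  by apply: filterS FT => x _; apply/sphereE; exact: sphere_dot.
exists (point_of ((sphereE x).1 Sx)); split => // A B FA [_ [[W oW <-] Wx WB]].
have [|_ [[z Az <-] Wz]] := Fx (\val @` A) W _ (open_nbhs_nbhs (conj oW Wx)).
  suff : F (\val @^-1` (\val @` A)) by [].
  by apply: filterS FA => z Az; exists z.
by exists z; split => //; exact: WB.
Qed.

(** Stereographic projection from [q], translated so that [p] is the origin. *)
Lemma stereographic_chart (p q : X) : p != q ->
  exists (g : 'rV[R]_n -> X) (h : X -> 'rV[R]_n), [/\ continuous g, cancel g h, g 0 = p,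
    forall y, g y != q & (forall x, x != q -> g (h x) = x) /\
      {within [set x | x != q], continuous h}].
Proof.
move=> pq; have q1 := sphere_dot q; have p1 := sphere_dot p.
set P := \val p in p1; set Q := \val q in q1.
have PQ : dot P Q != 1 by apply: unit_dot_neq1.
have Q0 : Q != 0 by rewrite -dot_eq0 q1 oner_eq0.
have [B [C [BC BQ CB]]] := orthogonal_basis Q0.
pose v0 := stereo Q P; have v0Q : dot v0 Q = 0 by exact: stereo_orthogonal.
pose v (y : 'rV[R]_n) := y *m B + v0.
have vQ y : dot (v y) Q = 0 by rewrite dotDl BQ v0Q addr0.
pose g y := point_of (inverse_stereo_unit q1 (vQ y)).
pose h (x : X) := (stereo Q (\val x) - v0) *m C.
have gE y : \val (g y) = inverse_stereo Q (v y) by [].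
exists g, h; split.
- apply: cont_sphere; apply: cont_rV => i.
  have cv j : continuous (fun y => v y 0 j).
    rewrite (_ : (fun _ => _) = fun y : 'rV[R]_n => \sum_k y 0 k * B k j + v0 0 j).
      apply: cont_add; last exact: cont_cst.
      apply: cont_sum => k; apply: cont_mul; last exact: cont_cst.
      exact: coord_continuous.
    by apply/funext => y; rewrite !mxE.
  have cvv : continuous (fun y => dot (v y) (v y)).
    by apply: (cont_comp (g := fun x => dot x x)); [exact: cont_dot_self|exact: cont_rV].
  rewrite (_ : (fun _ => _) = fun y => (dot (v y) (v y) + 1)^-1 *
     (2 * v y 0 i + (dot (v y) (v y) - 1) * Q 0 i)).
    apply: cont_mul.
      by apply: cont_inv; [move=> y; rewrite gt_eqF// dotvv1_gt0|cont].
    by have cvi := cv i; cont.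
  by apply/funext => y; rewrite gE !mxE.
- by move=> y; rewrite /h gE inverse_stereoK// addrK -mulmxA BC mulmx1.
- apply: val_inj; rewrite gE /v mul0mx add0r; exact: stereoK.
- move=> y; apply/eqP => /(congr1 \val); rewrite gE -/Q => yQ.
  have := inverse_stereo_dot q1 (vQ y); rewrite yQ q1 subrr => /esym/eqP.
  by rewrite mulf_eq0 pnatr_eq0/= invr_eq0 gt_eqF// dotvv1_gt0.
have xQ (x : X) : x != q -> dot (\val x) Q != 1.
  by move=> xq; apply: unit_dot_neq1 => //; exact: sphere_dot.
split => [x xq|].
  apply: val_inj; rewrite gE /h /v CB; last first.
    by rewrite dotDl dotNl stereo_orthogonal// v0Q subr0.
  by rewrite subrK stereoK//; [exact: sphere_dot|exact: xQ].
apply: cont_rV => k.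
have cx j : continuous (fun z : X => \val z 0 j).
  by apply: (cont_comp (g := fun z : 'rV[R]_n.+1 => z 0 j));
    [exact: coord_continuous|exact: cont_val].
have cd : continuous (fun z : X => dot (\val z) Q).
  by apply: (cont_comp (g := fun z => dot z Q)); [exact: cont_dotr|exact: cont_val].
rewrite (_ : (fun _ => _) = fun z : X => \sum_j ((1 - dot (\val z) Q)^-1 *
    (\val z 0 j - dot (\val z) Q * Q 0 j) - v0 0 j) * C j k); last first.
  by apply/funext => z; rewrite !mxE; apply: eq_bigr => j _; rewrite !mxE.
apply: cont_sum => j; apply: cont_mul; last exact: cont_cst.
apply: cont_add; last exact: cont_cst.
have c1 : continuous (fun z : X => \val z 0 j - dot (\val z) Q * Q 0 j).
  by have cxj := cx j; cont.
have c2 : continuous (fun z : X => 1 - dot (\val z) Q) by cont.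
apply: cont_mul; last exact: (continuous_subspaceT c1).
apply: cont_inv_within; last exact: (continuous_subspaceT c2).
by move=> z /xQ; rewrite eq_sym -subr_eq0.
Qed.

End sphere_topology.

(** * Continuity of Darboux bijections of spheres *)

Lemma connected_norm_ball (R : realType) (V : normedModType R) (e : R) :
  0 < e -> connected [set y : V | `|y| < e].
Proof.
move=> e0; pose seg (y : V) := (fun t : R => t *: y) @` `[0, 1].
have segE y t : 0 <= t <= 1 -> seg y (t *: y) by move=> t01; exists t => //; rewrite /= in_itv.
rewrite (_ : [set y | _] = \bigcup_(y in [set y : V | `|y| < e]) seg y).
  apply: bigcup_connected.
    by exists 0 => y _; rewrite -(scale0r y); apply: segE; rewrite lexx ler01.
  move=> y _; apply: connected_continuous_connected; first exact: segment_connected.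
  by apply: continuous_subspaceT; exact: scalel_continuous.
apply/seteqP; split => [y ye|_ [y ye [t /= + <-]]].
  by exists y => //; rewrite -{2}(scale1r y); apply: segE; rewrite lexx ler01.
rewrite in_itv/= => /andP[t0 t1]; rewrite normrZ ger0_norm//.
by rewrite (le_lt_trans _ ye)// ler_piMl.
Qed.

Section darboux_injections.
Context {R : realType} {n : nat}.

Let X : pseudoMetricType R := sphere R n.

Lemma sphere_antipode (p : X) : exists q : X, p != q.
Proof.
have np : dot (- \val p) (- \val p) = 1 by rewrite !dot_linear opprK sphere_dot.
exists (point_of np); apply/eqP => /(congr1 (fun x : X => dot (\val x) (\val p))) /=.
by rewrite dotNl sphere_dot; lra.
Qed.

Lemma sphere_locally_connected : @locally_connected X.
Proof.
move=> p O pO; have [q pq] := sphere_antipode p.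
have [g [h [cg gK g0 gq [hK ch]]]] := stereographic_chart pq.
have : nbhs (0 : 'rV[R]_n) (g @^-1` O) by apply: cg; rewrite g0.
move=> /nbhs_normP[e /= e0 eO].
pose D := [set y : 'rV[R]_n | `|y| < e].
exists (g @` D); split.
- apply: connected_continuous_connected; first exact: connected_norm_ball.
  exact: continuous_subspaceT.
- by move=> _ [y ye <-]; apply: eO; rewrite /= sub0r normrN.
have oq : open [set x : X | x != q].
  rewrite (_ : [set x | _] = ~` [set q]).
    apply: closed_openC; apply: accessible_closed_set1.
    by apply: hausdorff_accessible; exact: sphere_hausdorff.
  by apply/seteqP; split => x /= /eqP.
have hp : h p = 0 by rewrite -g0 gK.
have nD : nbhs (h p) D.
  by rewrite hp; exact: (@nbhs0_lt R 'rV[R]_n).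
have nhD : nbhs p (h @^-1` D).
  by move: ch; rewrite continuous_open_subspace// => /(_ p); apply; rewrite ?inE.
apply: filterS (filterI nhD (open_nbhs_nbhs (conj oq pq))) => x [hx xq].
by exists (h x) => //; exact: hK.
Qed.

Variable f : X -> X.
Hypothesis f_inj : injective f.
Hypothesis f_darboux : Darboux f.

Let coord i (x : X) : R := \val (f x) 0 i.

Lemma connected_coord i C : connected C -> connected (coord i @` C).
Proof.
move=> /f_darboux cC.
have -> : coord i @` C = (fun y : X => \val y 0 i) @` (f @` C) by rewrite image_comp.
apply: connected_continuous_connected => //; apply: continuous_subspaceT.
apply: (cont_comp (g := fun y : 'rV[R]_n.+1 => y 0 i)); last exact: cont_val.
exact: coord_continuous.
Qed.

Let axis i : 'rV[R]_n.+1 := delta_mx 0 i.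

Lemma dot_axis i x : dot (axis i) x = x 0 i.
Proof.
rewrite dotE (bigD1 i)//= mxE !eqxx mul1r big1 ?addr0// => j ji.
by rewrite mxE (negbTE ji) andbF mul0r.
Qed.

Lemma axis_unit i : dot (axis i) (axis i) = 1.
Proof. by rewrite dot_axis mxE !eqxx. Qed.

Lemma level_section i (x : 'rV[R]_n.+1) c : dot x x = 1 ->
  x 0 i = c <-> section (axis i) (c *: axis i) x.
Proof.
move=> x1; have E : dot (axis i) (x - c *: axis i) = x 0 i - c.
  by rewrite !dot_linear axis_unit dot_axis mulr1.
split => [xc|[_ h]].
  split => //; apply/matrixP => a b; rewrite !ord1 [RHS]mxE.
  by rewrite -[LHS]/(dot _ _) E xc subrr.
by apply/eqP; rewrite -subr_eq0 -E /dot h mxE.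
Qed.

Lemma rank_axis i : \rank (axis i) = 1%N.
Proof. by rewrite rank_rV -dot_eq0 axis_unit oner_eq0. Qed.

Lemma closed_at_most_two (A : set X) :
  (forall x y z, A x -> A y -> A z -> x != z -> y = x \/ y = z) -> closed A.
Proof.
have cl1 x : closed [set x : X].
  apply: accessible_closed_set1; apply: hausdorff_accessible; exact: sphere_hausdorff.
move=> A2; have [[x Ax]|nA] := pselect (exists x, A x); last first.
  rewrite (_ : A = set0); first exact: closed0.
  by rewrite -subset0 => x Ax; apply: nA; exists x.
have [[z Az xz]|nz] := pselect (exists2 z, A z & x != z); last first.
  rewrite (_ : A = [set x])//; apply/seteqP; split => [y Ay|y ->]//=.
  by apply: contrapT => yx; apply: nz; exists y => //; apply/eqP => /esym.
rewrite (_ : A = [set x] `|` [set z]); first exact: closedU.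
apply/seteqP; split => [y Ay|y [->|->]]//.
by have [->|->] := A2 x y z Ax Ay Az xz; [left|right].
Qed.

(** A hyperplane that does not cut the sphere properly meets it at most at one pole. *)
Lemma closed_level_extreme i c : c <= -1 \/ 1 <= c -> closed [set x | coord i x = c].
Proof.
move=> hc; apply: closed_at_most_two => x y z xc yc zc /eqP[]; apply: f_inj; apply: val_inj.
have uniq (w : X) : coord i w = c -> \val (f w) = (if c <= -1 then - axis i else axis i).
  move=> wc; have w1 := sphere_dot (f w); have a1 := axis_unit i.
  have wa : dot (\val (f w)) (axis i) = c by rewrite dotC dot_axis.
  apply/eqP; case: ifPn => [c1|/negP c1].
    rewrite -subr_eq0 opprK -dot_eq0 eq_le dot_ge0 andbT.
    by rewrite !dot_linear (dotC (axis i)) w1 a1 wa; lra.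
  have {}hc : 1 <= c by case: hc.
  rewrite -subr_eq0 -dot_eq0 eq_le dot_ge0 andbT.
  by rewrite !dot_linear (dotC (axis i)) w1 a1 wa; lra.
by rewrite !uniq.
Qed.

(** On a sphere of dimension at most one, levels have at most two points. *)
Lemma closed_level_low_dim i c : (n <= 1)%N -> closed [set x | coord i x = c].
Proof.
move=> n1; apply: closed_at_most_two => x y z xc yc zc xz.
have S w : coord i w = c -> section (axis i) (c *: axis i) (\val (f w)).
  by move=> wc; apply/level_section => //; exact: sphere_dot.
have [||E|E] := section_line _ (S x xc) (S y yc) (S z zc).
- by rewrite rank_axis ltnS.
- by apply: contra xz => /eqP/val_inj/f_inj ->.
- by left; apply: f_inj; exact: val_inj.
- by right; apply: f_inj; exact: val_inj.
Qed.

Hypothesis f_surj : forall y, exists x, f x = y.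

(** As [f] is Darboux, the preimage [C] of the level separates the sphere, so that a
    closed set [A `&` B] inside [C] already does. In the stereographic chart that set
    encloses the origin, so by the filling property its image is the whole level:
    [C] is that closed set. *)
Lemma closed_level_high_dim i c : enclosing_filling R n -> closed [set x | coord i x = c].
Proof.
move=> fill; have [c1|c1] := leP c (-1); first by apply: closed_level_extreme; left.
have [c2|c2] := leP 1 c; first by apply: closed_level_extreme; right.
pose C := [set x | coord i x = c]; rewrite -/C.
have nC : ~ connected ([set: X] `\` C).
  move=> hC; have /connected_intervalP itv := connected_coord (i := i) hC.
  have na : dot (- axis i) (- axis i) = 1 by rewrite !dot_linear opprK axis_unit.
  have [x xE] := f_surj (point_of (axis_unit i)).
  have [y yE] := f_surj (point_of na).
  have cx : coord i x = 1 by rewrite /coord xE /= mxE !eqxx.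
  have cy : coord i y = -1 by rewrite /coord yE /= !mxE !eqxx.
  have [|||z [_ nz] zc] := itv (-1) 1 _ _ c.
  - by exists y => //; split => //; rewrite /C /= cy => h; move: c1; rewrite -h ltxx.
  - by exists x => //; split => //; rewrite /C /= cx => h; move: c2; rewrite -h ltxx.
  - by rewrite !ltW.
  - exact: nz.
have [A [B [cA cB AB ABC [[p _ nAp] [q _ nBq]]]]] := disconnected_closed_cover closedT nC.
have Bp x : ~ A x -> B x by have : (A `|` B) x by [rewrite AB]; case.
have pq : p != q by apply/eqP => pq; apply: nBq; rewrite -pq; exact: Bp.
have [g [h [cg gK g0 gq [hK ch]]]] := stereographic_chart pq.
pose F := g @^-1` (A `&` B).
have cgB : compact (g @^-1` B).
  rewrite (_ : g @^-1` B = h @` B).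
    apply: continuous_compact; last first.
      exact: (subclosed_compact cB sphere_compact).
    apply: continuous_subspaceW ch => x Bx /=; apply/eqP => xq.
    by apply: nBq; rewrite -xq.
  apply/seteqP; split => [y Bgy|_ [x Bx <-]]; first by exists (g y).
  by rewrite /preimage /= hK//; apply/eqP => xq; apply: nBq; rewrite -xq.
have hV : hausdorff_space 'rV[R]_n by exact: norm_hausdorff.
have clg (D : set X) : closed D -> closed (g @^-1` D).
  by move=> cD; apply: closed_comp => // y _; exact: cg.
have cF : compact F.
  apply: (subclosed_compact _ cgB); last by move=> y [].
  by apply: clg; exact: closedI.
have eF : encloses_origin F.
  have [M [_ MB]] := compact_bounded cgB.
  have UE : (g @^-1` (~` A)) `|` F = g @^-1` B.
    apply/seteqP; split => [y [nAy|[]//]|y By].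
      exact: Bp.
    by have [Ay|nAy] := pselect (A (g y)); [right|left].
  exists (g @^-1` (~` A)), (`|M| + 2); split.
  - by apply: open_comp => [y _|]; [exact: cg|exact: closed_openC].
  - by rewrite /preimage /= g0.
  - by rewrite -subset0 => y [nAy [Ay _]].
  - by rewrite UE; exact: clg.
  - rewrite UE => y By; have := MB (`|M| + 1); rewrite (le_lt_trans (ler_norm M)) ?ltrDl//.
    by move=> /(_ isT y By) /le_lt_trans; apply; rewrite ltrD2l ltr1n.
have rA : (0 < \rank (axis i))%N by rewrite rank_axis.
pose fg (y : 'rV[R]_n) := \val (f (g y)).
have fgi : injective fg by move=> y z /val_inj/f_inj/(can_inj gK).
have fgc D : connected D -> connected (fg @` D).
  move=> cD; rewrite (_ : fg @` D = \val @` (f @` (g @` D))); last by rewrite !image_comp.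
  apply: connected_continuous_connected; last by apply: continuous_subspaceT; exact: cont_val.
  apply: f_darboux; apply: connected_continuous_connected => //.
  exact: continuous_subspaceT.
have fgF : fg @` F `<=` section (axis i) (c *: axis i).
  move=> _ [y Fy <-]; apply/level_section; first exact: sphere_dot.
  exact: ABC.
have sF := fill fg fgi (fun y => sphere_dot _) fgc F cF eF _ _ _ rA fgF.
rewrite (_ : C = A `&` B); first exact: closedI.
apply/seteqP; split => // x xc.
have [|y Fy yx] := sF (\val (f x)).
  by apply/level_section => //; exact: sphere_dot.
by have <- : g y = x by apply: f_inj; exact: val_inj.
Qed.

Lemma continuous_of_closed_levels : (forall i c, closed [set x | coord i x = c]) -> continuous f.
Proof.
move=> cl; apply: cont_sphere; apply: cont_rV => i.
by apply: closed_fibers_continuous;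
  [exact: sphere_locally_connected|exact: connected_coord|exact: cl].
Qed.

End darboux_injections.

Lemma compact_inverse_continuous (X Y : topologicalType) (f : X -> Y) (g : Y -> X) :
  compact [set: X] -> hausdorff_space Y -> continuous f -> cancel f g -> cancel g f ->
  continuous g.
Proof.
move=> cX hY cf fK gK; apply/continuous_closedP => D cD.
rewrite (_ : g @^-1` D = f @` D).
  apply: compact_closed => //; apply: continuous_compact; first exact: continuous_subspaceT.
  exact: subclosed_compact cD cX _.
apply/seteqP; split => [y Dgy|_ [x Dx <-]]; first by exists (g y).
by rewrite /preimage /= fK.
Qed.

Theorem corollary1p5 (R : realType) (n : nat) (hn : (n <= 3)%N)
  (f : sphere R n -> sphere R n) (f_bij : bijective f) (f_darboux : Darboux f) :
  homeomorphism f.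
Proof.
have f_inj := bij_inj f_bij; have [g fK gK] := f_bij.
have f_surj y : exists x, f x = y by exists (g y).
have cf : continuous f.
  apply: continuous_of_closed_levels => // i c.
  move: hn; rewrite leq_eqVlt => /orP[/eqP n3|].
    by apply: closed_level_high_dim => //; rewrite n3; exact: enclosing_filling3.
  rewrite ltnS leq_eqVlt => /orP[/eqP n2|].
    by apply: closed_level_high_dim => //; rewrite n2; exact: enclosing_filling2.
  exact: closed_level_low_dim.
split => //; exists g; split => //.
exact: (compact_inverse_continuous sphere_compact sphere_hausdorff cf fK gK).
Qed.
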